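(* Assume $mn\ge2$ and $K\ge1$. Let $H\in\mathbb S_{++}^{mn}$, $G\in\mathcal K_{m,n}$, and $$P=P_{\mathcal K}(H),\qquad R_G(H)=\log(G^{-1/2}HG^{-1/2}),\qquad V(G)=\Pi_{\mathcal L}R_G(H).$$ Set $$\eta=\|V(G)\|_F,\quad \rho=d_{\mathrm{AI}}(H,G),\quad \delta_-=\sqrt{\max\{\rho^2-\eta^2,0\}},\quad \kappa_G=\kappa(G^{-1}H),\quad \alpha_{mn}=\sqrt{\frac{mn}{\lfloor (mn)^2/4\rfloor}}.$$ Then $$\delta_-\le d_{\mathrm{AI}}(H,\mathcal K_{m,n})\le\rho\qquad\text{and}\qquad \exp(\alpha_{mn}\delta_-)\le K_{\mathcal K}^\star(H)\le\kappa_G.$$ Consequently, if $\kappa_G\le K$, then $G\in\mathcal R_{K,\mathcal K}(H)$ and, for every $G_0\in\mathcal K_{m,n}$ with $S_0=H^{-1/2}G_0H^{-1/2}$, $$D_{K,\mathcal K}(S_0;H)\le d_{\mathrm{AI}}(G_0,G).$$ Moreover, with $\kappa_P=\kappa(P^{-1}H)$, $$e^{-2\eta}\kappa_G\le\kappa_P\le e^{2\eta}\kappa_G.$$ Writing $\delta_\star=d_{\mathrm{AI}}(H,\mathcal K_{m,n})$, $$0\le\log\frac{\kappa_P}{K_{\mathcal K}^\star(H)}\le\log\kappa_P-\alpha_{mn}\delta_\star\le\log\kappa_G+2\eta-\alpha_{mn}\delta_-.$$ Thus $e^{2\eta}\kappa_G\le K$ implies $\kappa(P^{-1}H)\le K$,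 while $e^{-2\eta}\kappa_G>K$ implies $\kappa(P^{-1}H)>K$. Finally, if $\exp(\alpha_{mn}\delta_-)>K$, then $\mathcal R_{K,\mathcal K}(H)=\emptyset$.
   Context: $\mathbb S^d$ denotes real symmetric $d\times d$ matrices and $\mathbb S_{++}^d$ the positive-definite ones, with the affine-invariant Riemannian metric $\|Z\|_{S,\mathrm{AI}}=\|S^{-1/2}ZS^{-1/2}\|_F$ and distance $d_{\mathrm{AI}}(G_0,G_1)=\|\log(G_0^{-1/2}G_1G_0^{-1/2})\|_F$; $d_{\mathrm{AI}}(H,\mathcal K)$ is the infimum of distances from $H$ to points of $\mathcal K$. For $G,H\in\mathbb S_{++}^d$, $\kappa(G^{-1}H)$ is the ratio of the largest to the smallest generalized eigenvalue in $Hv=\lambda Gv$, and $\kappa(S)$ is the usual spectral condition number. The Kronecker family is $\mathcal K_{m,n}=\{B\otimes A: A\in\mathbb S_{++}^m,\ B\in\mathbb S_{++}^n\}\subset\mathbb S_{++}^{mn}$. For every $M\in\mathbb S_{++}^{mn}$ there is a unique point $P_{\mathcal K}(M)=\operatorname*{arg\,min}_{G\in\mathcal K_{m,n}}d_{\mathrm{AI}}(M,G)$. The log-Kronecker subspace is $\mathcal L_{m,n}=\{I_n\otimes X+Y\otimes I_m: X\in\mathbb S^m,\ Y\in\mathbb S^n\}$ and $\Pi_{\mathcal L}$ is the Frobenius-orthogonal projection of $\mathbb S^{mn}$ onto it. $K_{\mathcal K}^\star(H)=\min_{G\in\mathcal K_{m,n}}\kappa(G^{-1}H)$ (the minimum is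 attained) and $\mathcal R_{K,\mathcal K}(H)=\{G\in\mathcal K_{m,n}:\kappa(G^{-1}H)\le K\}$. $D_{K,\mathcal K}(S_0;H)$ is the infimum of the affine-invariant lengths of absolutely continuous curves in $\mathcal S_{\mathcal K}(H)=\{H^{-1/2}GH^{-1/2}:G\in\mathcal K_{m,n}\}$ that start at $S_0$ and end in $\{S\in\mathbb S_{++}^{mn}:\kappa(S)\le K\}$; it is $+\infty$ if there is no such curve. *)

(* Defs.v *)
From mathcomp Require Import all_boot all_order all_algebra.
From mathcomp Require Import mxtens.
From mathcomp Require Import all_classical all_reals all_analysis.

Set Implicit Arguments.
Unset Strict Implicit.
Unset Printing Implicit Defensive.

Import Order.TTheory GRing.Theory Num.Theory.
Import numFieldNormedType.Exports.

Local Open Scope classical_set_scope.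
Local Open Scope ring_scope.

Section SymmetricMatrices.
Context {R : realType} {d : nat}.
Implicit Types (A B S Z G H : 'M[R]_d).

Definition symmx : set 'M[R]_d := [set S | S^T = S].

Definition posdefmx : set 'M[R]_d :=
  [set S | symmx S /\
           forall v : 'cV[R]_d, v != 0 -> 0 < (v^T *m S *m v) 0 0].

(* Spectral calculus: if A = U diag(a) U^T with U orthogonal, then
   f(A) = U diag(f(a)) U^T. For symmetric A this matrix exists and does not
   depend on the diagonalization; for other A the value is 0. *)
Definition spectral_fun (f : R -> R) A : 'M[R]_d :=
  xget 0 [set B | exists (U : 'M[R]_d) (a : 'rV[R]_d),
    [/\ U^T *m U = 1%:M, A = U *m diag_mx a *m U^T &
        B = U *m diag_mx (map_mx f a) *m U^T]].

Definition logmx S := spectral_fun (@ln R) S.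

Definition invsqrtmx S := spectral_fun (fun x => (Num.sqrt x)^-1) S.

Definition frob_dot A B : R := \tr (A^T *m B).

Definition frob_norm A : R := Num.sqrt (frob_dot A A).

Definition normAI S Z : R := frob_norm (invsqrtmx S *m Z *m invsqrtmx S).

(* Riemannian logarithm of H at G, in the whitened coordinates at G *)
Definition whitened_log G H := logmx (invsqrtmx G *m H *m invsqrtmx G).

Definition dAI G H : R := frob_norm (whitened_log G H).

Definition dAI_set H (E : set 'M[R]_d) : R := inf [set dAI H G | G in E].

Definition gen_eigenvalue G H (l : R) : Prop :=
  exists2 v : 'cV[R]_d, v != 0 & H *m v = l *: (G *m v).

(* kappa(G^-1 H) *)
Definition kappa_pencil G H : R :=
  sup [set l | gen_eigenvalue G H l] / inf [set l | gen_eigenvalue G H l].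

(* The spectral condition number of a positive definite S *)
Definition kappa S : R :=
  sup [set l | eigenvalue S l] / inf [set l | eigenvalue S l].

Definition abs_continuous01 (c : R -> 'M[R]_d) : Prop :=
  forall e : R, 0 < e -> exists2 del : R, 0 < del &
  forall (k : nat) (a b : 'I_k -> R),
    (forall i, [/\ 0 <= a i, a i <= b i & b i <= 1]) ->
    (forall i j, i != j -> b i <= a j \/ b j <= a i) ->
    \sum_(i < k) (b i - a i) < del ->
    \sum_(i < k) frob_norm (c (b i) - c (a i)) < e.

(* An absolutely continuous curve is differentiable almost everywhere; on the
   remaining null set derive1 c has an arbitrary value. *)
Definition lengthAI (c : R -> 'M[R]_d) : \bar R :=
  (\int[lebesgue_measure]_(t in `[0%R, 1%R]) (normAI (c t) (derive1 c t))%:E)%E.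

End SymmetricMatrices.

Section Kronecker.
Context {R : realType} {m n : nat}.
Local Notation mat := 'M[R]_(n * m).
Implicit Types (M G H S : mat) (K : R).

(* tensmx B A is the Kronecker product B (x) A: the block matrix whose (i, j)
   block is B i j *: A. *)
Definition kron_family : set mat :=
  [set M | exists (A : 'M[R]_m) (B : 'M[R]_n),
    [/\ posdefmx A, posdefmx B & M = tensmx B A]].

Definition kron_proj M : mat :=
  xget 0 [set P | kron_family P /\
                  forall G, kron_family G -> dAI M P <= dAI M G].

Definition log_kron : set mat :=
  [set Z | exists (X : 'M[R]_m) (Y : 'M[R]_n),
    [/\ symmx X, symmx Y & Z = tensmx 1%:M X + tensmx Y 1%:M]].

Definition log_kron_proj (Z : mat) : mat :=
  xget 0 [set W | log_kron W /\
                  forall L, log_kron L -> frob_dot (Z - W) L = 0].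

(* The infimum is attained. *)
Definition kron_kappa_min H : R :=
  inf [set kappa_pencil G H | G in kron_family].

Definition kron_region K H : set mat :=
  [set G | kron_family G /\ kappa_pencil G H <= K].

Definition whiten H G : mat := invsqrtmx H *m G *m invsqrtmx H.

Definition whitened_kron H : set mat := [set whiten H G | G in kron_family].

(* The infimum of the empty set is +oo. *)
Definition kron_cost K S0 H : \bar R :=
  ereal_inf [set lengthAI c | c in [set c : R -> mat |
    [/\ abs_continuous01 c,
        forall t, 0 <= t <= 1 -> whitened_kron H (c t),
        c 0 = S0 & posdefmx (c 1) /\ kappa (c 1) <= K]]].

Definition alpha : R :=
  Num.sqrt ((m * n)%:R / ((m * n) ^ 2 %/ 4)%N%:R).

End Kronecker.

Arguments kron_family {R} m n _.
Arguments log_kron {R} m n _.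
Arguments alpha R m n : clear implicits.

(* Main.v *)
Require Import Defs.
From HB Require Import structures.
From mathcomp Require Import all_boot all_order all_algebra.
From mathcomp Require Import mxtens complex.
From mathcomp Require Import all_classical all_reals all_analysis.
From mathcomp Require Import ring lra.

Set Implicit Arguments.
Unset Strict Implicit.
Unset Printing Implicit Defensive.

Import Order.TTheory GRing.Theory Num.Theory.
Import numFieldNormedType.Exports.

Local Open Scope classical_set_scope.
Local Open Scope ring_scope.

(** The positive definite matrices with the affine-invariant distance d form a space of
    nonpositive curvature; the Kronecker family K is geodesically convex in it, and the
    geodesics leaving G inside K have their initial directions in the log-Kronecker
    subspace L. All the distance bounds follow from one contraction property: at every
    base point B, the whitened logarithm satisfies |log_B A - log_B C|_F <= d(A, C)
    ([frob_whitened_log_le_dAI]).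

    At base point G, write R for the whitened logarithm of H and V for its projection on L.
    For G' in K the whitened logarithm of G' lies in L, so d(H, G') >= |R - V|_F, whose
    square is rho^2 - eta^2. This is the lower bound on the distance to K.

    At a base point inside a geodesic, the same property gives the CAT(0) inequality
    ([dAI_geodesic_cat0]). Hence minimizing sequences for the distance from H to K are
    Cauchy and P exists ([kron_proj_exists]), and
    d(H, P)^2 + d(G, P)^2 <= d(H, G)^2 for G in K ([dAI_kron_proj_pythagoras]). Together with
    the contraction at G this forces d(G, P) <= eta ([dAI_kron_proj_le]). Since
    exp(-d(G, P)) G <= P <= exp(d(G, P)) G as quadratic forms, the condition numbers of
    the pencils at G and P differ at most by the factor exp(2 eta).

    The contraction itself is elementary. For S = U diag(exp x) U^T and
    T = V diag(exp y) V^T put W = U^T V. Then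
    |log S - log T|_F^2 = sum_ij W_ij^2 (x_i - y_j)^2, whereas
    sum_ij W_ij^2 (exp (x_i - y_j) + exp (y_j - x_i) - 2)
      = tr (S T^-1) + tr (T S^-1) - 2 N = sum_i (exp u_i + exp (- u_i) - 2),
    with N the size of the matrices and exp u_i the eigenvalues of T^-1 S
    ([chord_mixed_bases]). As z^2 <= exp z + exp (- z) - 2, the first sum is at most the
    second. Applied to the 2^p pieces of the subdivided geodesic from T to S, this bound
    tends to sum_i u_i^2 = d(T, S)^2. Read backwards, the identity bounds d by the Frobenius
    distance of the logarithms on bounded sets, which is the continuity needed for the
    existence of P.

    For the optimal condition number, rescaling G inside K centers the log-spectrum u of
    the pencil. A centered vector whose entries span an interval of length log kappa has
    squared norm at most floor(N^2 / 4) / N * (log kappa)^2, here with N = m n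
    ([popoviciu]), so alpha * d(H, K) <= log kappa ([alpha_dAI_set_le]).

    For the cost, the geodesic from G0 to G, whitened by H, is an admissible curve
    of constant speed d(G0, G) ([kron_cost_le]). *)

(** * The real spectral theorem *)

Section RealSpectralTheorem.
Context {R : realType}.

Lemma sqr_col_sum (d : nat) (v : 'cV[R]_d) : (v^T *m v) 0 0 = \sum_i v i 0 ^+ 2.
Proof. by rewrite mxE; apply: eq_bigr => i _; rewrite mxE expr2. Qed.

Lemma sqr_col_gt0 (d : nat) (v : 'cV[R]_d) : (0 < (v^T *m v) 0 0) = (v != 0).
Proof.
have sq_ge0 i : true -> 0 <= v i 0 ^+ 2 by rewrite sqr_ge0.
rewrite sqr_col_sum lt0r sumr_ge0 // andbT; congr negb.
rewrite psumr_eq0 //; apply/idP/eqP => [/allP v0|->]; last first.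
  by apply/allP => i _; rewrite mxE expr0n eqxx implybT.
apply/matrixP => i j; rewrite (ord1 j) [RHS]mxE.
by have := v0 i (mem_index_enum i); rewrite /= sqrf_eq0 => /eqP.
Qed.

(** A complex eigenvector x + i y with eigenvalue p + i q exists. Comparing <A x, y> with
    <x, A y> gives q (|x|^2 + |y|^2) = 0, so q = 0 and both x and y solve A v = p v. *)
Lemma symmetric_eigenvector (d : nat) (A : 'M[R]_d.+1) : A^T = A ->
  exists (p : R) (v : 'cV[R]_d.+1), v != 0 /\ A *m v = p *: v.
Proof.
move=> Asym; pose Ac : 'M[R[i]]_d.+1 := map_mx (real_complex R) A.
have [[p q] /eigenvalueP[v vA v0]] := eigenvalue_closed Ac (ltn0Sn d).
pose x : 'cV[R]_d.+1 := \col_j complex.Re (v 0 j).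
pose y : 'cV[R]_d.+1 := \col_j complex.Im (v 0 j).
have ReS (F : 'I_d.+1 -> R[i]) : complex.Re (\sum_j F j) = \sum_j complex.Re (F j).
  by apply: (big_morph (@complex.Re R)) => // -[? ?] [? ?].
have ImS (F : 'I_d.+1 -> R[i]) : complex.Im (\sum_j F j) = \sum_j complex.Im (F j).
  by apply: (big_morph (@complex.Im R)) => // -[? ?] [? ?].
have Ax : A *m x = p *: x - q *: y.
  apply/matrixP => k l; have /(congr1 (fun w : 'rV_d.+1 => complex.Re (w 0 k))) := vA.
  rewrite !mxE ReS => E; transitivity (complex.Re ((p +i* q)%C * v 0 k)); last first.
    by case: (v 0 k).
  rewrite -E; apply: eq_bigr => j _; rewrite !mxE -{1}Asym mxE.
  by case: (v 0 j) => a b /=; rewrite mulr0 subr0 mulrC.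
have Ay : A *m y = q *: x + p *: y.
  apply/matrixP => k l; have /(congr1 (fun w : 'rV_d.+1 => complex.Im (w 0 k))) := vA.
  rewrite !mxE ImS => E; transitivity (complex.Im ((p +i* q)%C * v 0 k)); last first.
    by case: (v 0 k) => a b /=; rewrite addrC.
  rewrite -E; apply: eq_bigr => j _; rewrite !mxE -{1}Asym mxE.
  by case: (v 0 j) => a b /=; rewrite mulr0 add0r mulrC.
have xyP : (x != 0) || (y != 0).
  rewrite -negb_and; apply: contra v0 => /andP[/eqP x0 /eqP y0].
  apply/eqP/matrixP => i j; rewrite (ord1 i) [RHS]mxE.
  move: x0 => /matrixP/(_ j 0); move: y0 => /matrixP/(_ j 0); rewrite !mxE.
  by case: (v 0 j) => a b /= -> ->.
have q0 : q = 0.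
  have E : y^T *m (A *m x) = (A *m y)^T *m x by rewrite trmx_mul Asym mulmxA.
  have xyC : (y^T *m x) 0 0 = (x^T *m y) 0 0.
    by rewrite -[in RHS](trmxK y) -trmx_mul [RHS]mxE.
  move: E; rewrite Ax Ay mulmxBr [(_ + _)^T]linearD /= mulmxDl ![(_ *: _)^T]linearZ /=.
  move=> /matrixP/(_ 0 0); rewrite -!scalemxAr -!scalemxAl.
  move: (sqr_col_gt0 x) (sqr_col_gt0 y) xyP; rewrite -(negbK (x == 0)) -(negbK (y == 0)).
  have xx : 0 <= (x^T *m x) 0 0 by rewrite sqr_col_sum sumr_ge0 // => i _; rewrite sqr_ge0.
  have yy : 0 <= (y^T *m y) 0 0 by rewrite sqr_col_sum sumr_ge0 // => i _; rewrite sqr_ge0.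
  have entry (B : 'M[R]_1) c : (c *: B) 0 0 = c * B 0 0 by rewrite mxE.
  have entryD (B C : 'M[R]_1) : (B + C) 0 0 = B 0 0 + C 0 0 by rewrite mxE.
  have entryN (B : 'M[R]_1) : (- B) 0 0 = - B 0 0 by rewrite mxE.
  rewrite !negbK => <- <-; rewrite !entryD entryN !entry => xy E.
  have : q * ((x^T *m x) 0 0 + (y^T *m y) 0 0) = 0 by lra.
  move=> /eqP; rewrite mulf_eq0 => /orP[/eqP //|/eqP s0].
  by move: xy => /orP[]; lra.
rewrite q0 !scale0r subr0 add0r in Ax Ay.
by case/orP: xyP => w0; [exists p, x|exists p, y].
Qed.

(** The matrix is the Householder reflection exchanging the first basis vector and [u]. *)
Lemma orthogonal_with_first_column (d : nat) (u : 'cV[R]_d.+1) :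
  (u^T *m u) 0 0 = 1 ->
  exists2 U : 'M[R]_d.+1, U^T *m U = 1%:M & U *m delta_mx 0 0 = u.
Proof.
move=> u1; pose e : 'cV[R]_d.+1 := delta_mx 0 0; pose w := u - e.
have [w0|wn0] := eqVneq w 0.
  by exists 1%:M; rewrite ?trmx1 mul1mx //; apply/esym/eqP; rewrite -subr_eq0 -/w w0.
have ww_gt0 : 0 < (w^T *m w) 0 0 by rewrite sqr_col_gt0.
pose c := 2 / (w^T *m w) 0 0; pose U := 1%:M - c *: (w *m w^T).
have Usym : U^T = U by rewrite linearB /= trmx1 linearZ /= trmx_mul trmxK.
have mulw (v : 'cV[R]_d.+1) : w *m (w^T *m v) = (w^T *m v) 0 0 *: w.
  by rewrite {1}[w^T *m v]mx11_scalar mul_mx_scalar.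
have Uv (v : 'cV[R]_d.+1) : U *m v = v - (c * (w^T *m v) 0 0) *: w.
  by rewrite mulmxBl mul1mx -scalemxAl -mulmxA mulw scalerA.
exists U.
  rewrite Usym {2}/U mulmxBr mulmx1 -scalemxAr mulmxA Uv.
  have -> : w - (c * (w^T *m w) 0 0) *: w = - w.
    by rewrite /c divfK ?gt_eqF // scaler_nat mulr2n opprD addNKr.
  by rewrite mulNmx scalerN opprK /U subrK.
have ee : (e^T *m e) 0 0 = 1.
  rewrite sqr_col_sum (bigD1 0) //= big1 => [|i i0].
    by rewrite addr0 mxE !eqxx expr1n.
  by rewrite mxE (negbTE i0) expr0n.
have ue : (e^T *m u) 0 0 = (u^T *m e) 0 0.
  by rewrite -[in RHS](trmxK e) -trmx_mul [RHS]mxE.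
have entryB (B C : 'M[R]_1) : (B - C) 0 0 = B 0 0 - C 0 0 by rewrite !mxE.
have wwE : (w^T *m w) 0 0 = 2 - 2 * (u^T *m e) 0 0.
  rewrite /w [(_ - _)^T]linearB /= mulmxBl !mulmxBr !entryB u1 ee ue; lra.
have weE : (w^T *m e) 0 0 = (u^T *m e) 0 0 - 1.
  by rewrite /w [(_ - _)^T]linearB /= mulmxBl entryB ee.
rewrite Uv; have -> : c * (w^T *m e) 0 0 = -1.
  rewrite weE /c; apply: (@mulIf _ ((w^T *m w) 0 0)); first by rewrite gt_eqF.
  rewrite mulrAC divfK ?gt_eqF // wwE; lra.
by rewrite scaleN1r opprK /w addrC subrK.
Qed.

(** Conjugating by an orthogonal matrix whose first column is a unit eigenvector splits
    off a 1 x 1 block; the symmetric remainder is handled by induction. *)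
Theorem spectral_theorem (d : nat) (A : 'M[R]_d) : A^T = A ->
  exists (U : 'M[R]_d) (a : 'rV[R]_d),
    U^T *m U = 1%:M /\ A = U *m diag_mx a *m U^T.
Proof.
elim: d A => [|d IH] A Asym.
  by exists 0, 0; split; apply/matrixP => -[].
have [p [v [v0 Av]]] := symmetric_eigenvector Asym.
pose s := Num.sqrt ((v^T *m v) 0 0); pose u := s^-1 *: v.
have s0 : 0 < s by rewrite sqrtr_gt0 sqr_col_gt0.
have u1 : (u^T *m u) 0 0 = 1.
  rewrite /u [(_ *: _)^T]linearZ /= -scalemxAl -scalemxAr scalerA mxE -invfM -expr2.
  by rewrite sqr_sqrtr ?mulVf ?gt_eqF ?sqr_col_gt0 // ltW // sqr_col_gt0.
have Au : A *m u = p *: u by rewrite -scalemxAr Av !scalerA mulrC.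
have [U UU Ue] := orthogonal_with_first_column u1.
have UU' : U *m U^T = 1%:M by apply: mulmx1C.
have [B Bdef] : exists B : 'M[R]_(1 + d), B = U^T *m A *m U by exists (U^T *m A *m U).
have Bsym : B^T = B by rewrite Bdef !trmx_mul Asym trmxK mulmxA.
have Be : B *m delta_mx 0 0 = p *: delta_mx 0 0 :> 'cV_(1 + d).
  by rewrite Bdef -!mulmxA Ue Au -scalemxAr -Ue mulmxA UU mul1mx.
have B0 i : B i 0 = p * (i == 0)%:R.
  have /matrixP/(_ i 0) := Be; rewrite mxE (bigD1 0) //= big1 => [|j j0].
    by rewrite !mxE !eqxx !andbT mulr1 addr0.
  by rewrite !mxE (negbTE j0) mulr0.
have Bdr : (drsubmx B)^T = drsubmx B by rewrite trmx_drsub Bsym.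
have [U' [a' [UU1 BE]]] := IH _ Bdr.
have Bblock : B = block_mx p%:M 0 0 (drsubmx B).
  rewrite -{1}[B]submxK; congr block_mx; apply/matrixP => i j.
  - by rewrite (ord1 i) (ord1 j) !mxE lshift0 B0 !eqxx mulr1 mulr1n.
  - rewrite (ord1 i) !mxE -Bsym mxE lshift0 B0.
    by rewrite (_ : (_ == _) = false) // mulr0.
  by rewrite (ord1 j) !mxE lshift0 B0 (_ : (_ == _) = false) // mulr0.
pose W : 'M[R]_(1 + d) := block_mx 1%:M 0 0 U'.
have WT : W^T = block_mx 1%:M 0 0 U'^T by rewrite tr_block_mx trmx1 !trmx0.
have WW : W^T *m W = 1%:M.
  rewrite WT mulmx_block !(mulmx0, mul0mx, addr0, add0r, mulmx1) UU1.
  by rewrite -scalar_mx_block.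
have Wdiag : W *m diag_mx (row_mx p%:M a') *m W^T = B.
  have -> : diag_mx (row_mx p%:M a') = block_mx p%:M 0 0 (diag_mx a').
    rewrite diag_mx_row; congr block_mx.
    by apply/matrixP => i j; rewrite !ord1 !mxE.
  rewrite WT !mulmx_block !(mulmx0, mul0mx, addr0, add0r, mulmx1, mul1mx).
  by rewrite -BE -Bblock.
exists (U *m W), (row_mx p%:M a' : 'rV_(1 + d)); split.
  by rewrite trmx_mul mulmxA -(mulmxA W^T) UU mulmx1.
rewrite trmx_mul !mulmxA -(mulmxA U W) -(mulmxA U) Wdiag Bdef.
by rewrite !mulmxA UU' mul1mx -mulmxA UU' mulmx1.
Qed.

End RealSpectralTheorem.

(** * Frobenius geometry and spectral calculus *)

Lemma sqr_inj (R : realType) (x y : R) : 0 <= x -> 0 <= y -> x ^+ 2 = y ^+ 2 -> x = y.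
Proof. by move=> x0 y0; apply: pexpIrn. Qed.

Section Frobenius.
Context {R : realType} {d : nat}.
Implicit Types (A B C : 'M[R]_d).

Lemma frob_dotE A B : frob_dot A B = \sum_i \sum_j A i j * B i j.
Proof.
rewrite /frob_dot /mxtrace exchange_big /=; apply: eq_bigr => j _.
by rewrite mxE; apply: eq_bigr => i _; rewrite mxE.
Qed.

Lemma frob_dotC A B : frob_dot A B = frob_dot B A.
Proof. by rewrite /frob_dot -mxtrace_tr trmx_mul trmxK. Qed.

Lemma frob_dotDl A B C : frob_dot (A + B) C = frob_dot A C + frob_dot B C.
Proof. by rewrite /frob_dot [(_ + _)^T]linearD /= mulmxDl mxtraceD. Qed.

Lemma frob_dotZl (c : R) A B : frob_dot (c *: A) B = c * frob_dot A B.
Proof. by rewrite /frob_dot [(_ *: _)^T]linearZ /= -scalemxAl mxtraceZ. Qed.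

Lemma frob_dotDr A B C : frob_dot C (A + B) = frob_dot C A + frob_dot C B.
Proof. by rewrite !(frob_dotC C) frob_dotDl. Qed.

Lemma frob_dotZr (c : R) A B : frob_dot A (c *: B) = c * frob_dot A B.
Proof. by rewrite !(frob_dotC A) frob_dotZl. Qed.

Lemma frob_dot_ge0 A : 0 <= frob_dot A A.
Proof.
by rewrite frob_dotE; do 2!apply: sumr_ge0 => ? _; rewrite -expr2 sqr_ge0.
Qed.

Lemma frob_norm_ge0 A : 0 <= frob_norm A.
Proof. exact: sqrtr_ge0. Qed.

Lemma frob_norm_sqr A : frob_norm A ^+ 2 = frob_dot A A.
Proof. by rewrite sqr_sqrtr ?frob_dot_ge0. Qed.

Lemma frob_norm_sqrE A : frob_norm A ^+ 2 = \sum_i \sum_j A i j ^+ 2.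
Proof. by rewrite frob_norm_sqr frob_dotE. Qed.

Lemma frob_norm_sqrDZ (c : R) A B :
  frob_norm (A + c *: B) ^+ 2 =
  frob_norm A ^+ 2 + 2 * c * frob_dot A B + c ^+ 2 * frob_norm B ^+ 2.
Proof.
rewrite !frob_norm_sqr frob_dotDl !frob_dotDr frob_dotZl !frob_dotZr frob_dotZl.
by rewrite (frob_dotC B A); ring.
Qed.

Lemma frob_norm_sqrN A : frob_norm (- A) ^+ 2 = frob_norm A ^+ 2.
Proof. by rewrite !frob_norm_sqrE; do 2!apply: eq_bigr => ? _; rewrite mxE sqrrN. Qed.

Lemma frob_norm_orth (U V A : 'M[R]_d) : U^T *m U = 1%:M -> V^T *m V = 1%:M ->
  frob_norm (U *m A *m V^T) ^+ 2 = frob_norm A ^+ 2.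
Proof.
move=> UU VV; rewrite !frob_norm_sqr /frob_dot !trmx_mul trmxK !mulmxA.
rewrite mxtrace_mulC !mulmxA VV mul1mx -(mulmxA _ U^T) UU.
by rewrite mulmx1.
Qed.

Lemma frob_norm_diag (u : 'rV[R]_d) : frob_norm (diag_mx u) ^+ 2 = \sum_i u 0 i ^+ 2.
Proof.
rewrite frob_norm_sqrE; apply: eq_bigr => i _.
rewrite (bigD1 i) //= big1 ?addr0 => [|j ij]; first by rewrite !mxE eqxx mulr1n.
by rewrite !mxE eq_sym (negbTE ij) mulr0n expr0n.
Qed.

Lemma abs_entry_le_frob A i j : `|A i j| <= frob_norm A.
Proof.
rewrite -(@ler_pXn2r _ 2) ?nnegrE ?frob_norm_ge0 //.
rewrite frob_norm_sqrE -normrX ger0_norm ?sqr_ge0 // (bigD1 i) //= (bigD1 j) //=.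
rewrite -addrA lerDl addr_ge0 ?sumr_ge0 // => k _; rewrite ?sqr_ge0 //.
by rewrite sumr_ge0 // => l _; rewrite sqr_ge0.
Qed.

End Frobenius.

(** Locked, as [congexp] is: unification would otherwise compare two matrices with
    different log-spectra by unfolding the exponential of each entry. *)
HB.lock Definition exp_diag {R : realType} {d : nat} (u : 'rV[R]_d) : 'M[R]_d :=
  diag_mx (map_mx expR u).

(** The point at time 1 of the geodesic leaving [M *m M^T] with log-spectrum [u];
    the whole geodesic is [t |-> congexp M (t *: u)]. *)
HB.lock Definition congexp {R : realType} {d : nat} (M : 'M[R]_d) (u : 'rV[R]_d) :
  'M[R]_d := M *m exp_diag u *m M^T.

Section FunctionalCalculus.
Context {R : realType} {d : nat}.
Implicit Types (M U V S G H : 'M[R]_d) (u v a b : 'rV[R]_d).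

(** This is the independence of the spectral calculus from the diagonalization: if W
    intertwines two diagonal matrices, its entry (i, j) vanishes unless the i-th and j-th
    diagonal values agree, so W also intertwines their images under f. *)
Lemma spectral_funE (f : R -> R) U a : U^T *m U = 1%:M ->
  spectral_fun f (U *m diag_mx a *m U^T) = U *m diag_mx (map_mx f a) *m U^T.
Proof.
move=> UU; apply: xget_unique; first by exists U, a.
move=> _ [V [b [VV E ->]]]; pose W := V^T *m U.
have UU' : U *m U^T = 1%:M by apply: mulmx1C.
have WE : diag_mx b *m W = W *m diag_mx a.
  have := congr1 (fun X => V^T *m X *m U) E => /=.
  by rewrite /W !mulmxA VV mul1mx -mulmxA UU mulmx1 => <-.
have fW : diag_mx (map_mx f b) *m W = W *m diag_mx (map_mx f a).
  rewrite mul_diag_mx mul_mx_diag; apply/matrixP => i j; rewrite !mxE.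
  move: WE; rewrite mul_diag_mx mul_mx_diag => /matrixP/(_ i j).
  rewrite !mxE mulrC => /eqP; rewrite -subr_eq0 -mulrBr mulf_eq0.
  by case/orP => [/eqP ->|]; rewrite ?mulr0 ?mul0r // subr_eq0 => /eqP ->; rewrite mulrC.
have -> : V^T = W *m U^T by rewrite /W -mulmxA UU' mulmx1.
rewrite mulmxA -(mulmxA V) fW /W !mulmxA.
by rewrite (mulmx1C VV) mul1mx.
Qed.

Lemma exp_diagD u v : exp_diag u *m exp_diag v = exp_diag (u + v).
Proof.
by rewrite exp_diag.unlock mulmx_diag; congr diag_mx; apply/matrixP => i j; rewrite !mxE ord1 expRD.
Qed.

Lemma exp_diag0 : exp_diag (0 : 'rV[R]_d) = 1%:M.
Proof.
by rewrite exp_diag.unlock; apply/matrixP => i j; rewrite !mxE expR0.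
Qed.

Lemma tr_exp_diag u : (exp_diag u)^T = exp_diag u.
Proof. by rewrite exp_diag.unlock tr_diag_mx. Qed.

Lemma exp_diag_unit u : exp_diag u \in unitmx.
Proof.
by have /mulmx1_unit[] : exp_diag u *m exp_diag (- u) = 1%:M by rewrite exp_diagD subrr exp_diag0.
Qed.

Lemma congexp_congr N M u : N *m congexp M u *m N^T = congexp (N *m M) u.
Proof. by rewrite congexp.unlock trmx_mul !mulmxA. Qed.

Lemma congexp0 M : congexp M 0 = M *m M^T.
Proof. by rewrite congexp.unlock exp_diag0 mulmx1. Qed.

(** Moving the base point along its own geodesic: seen from time 1 of the direction u, the
    geodesics with the same M have their log-spectra translated by u. *)
Lemma congexp_shift M u v :
  congexp (M *m exp_diag (2^-1 *: u)) v = congexp M (u + v).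
Proof.
rewrite congexp.unlock; have <- : exp_diag (2^-1 *: u) *m exp_diag v *m exp_diag (2^-1 *: u) = exp_diag (u + v).
  rewrite !exp_diagD addrAC -scalerDl (_ : 2^-1 + 2^-1 = 1 :> R) ?scale1r //; lra.
by rewrite trmx_mul tr_exp_diag !mulmxA.
Qed.

Lemma congexp_base M u :
  congexp M u = (M *m exp_diag (2^-1 *: u)) *m (M *m exp_diag (2^-1 *: u))^T.
Proof. by rewrite -congexp0 congexp_shift addr0. Qed.

Lemma logmx_congexp U u : U^T *m U = 1%:M -> logmx (congexp U u) = U *m diag_mx u *m U^T.
Proof.
move=> UU; rewrite /logmx congexp.unlock exp_diag.unlock spectral_funE //; congr (_ *m diag_mx _ *m _).
by apply/matrixP => i j; rewrite !mxE expRK.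
Qed.

Lemma invsqrtmx_congexp U u : U^T *m U = 1%:M ->
  invsqrtmx (congexp U u) = congexp U (- 2^-1 *: u).
Proof.
move=> UU; rewrite /invsqrtmx congexp.unlock exp_diag.unlock spectral_funE //.
congr (_ *m diag_mx _ *m _); apply/matrixP => i j; rewrite !mxE mulNr expRN.
congr _^-1; apply: (sqr_inj (sqrtr_ge0 _) (expR_ge0 _)).
by rewrite sqr_sqrtr ?expR_ge0 // -expRM_natr; congr expR; rewrite mulrC mulrA divff ?mul1r.
Qed.

Lemma mul_congexp_orth U u v : U^T *m U = 1%:M ->
  congexp U u *m congexp U v = congexp U (u + v).
Proof.
move=> UU; rewrite congexp.unlock !mulmxA -(mulmxA _ U^T) UU mulmx1 -(mulmxA U).
by rewrite exp_diagD.
Qed.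

Lemma quad_congexp M u (v : 'cV[R]_d) :
  (v^T *m congexp M u *m v) 0 0 = \sum_i expR (u 0 i) * (M^T *m v) i 0 ^+ 2.
Proof.
have -> : v^T *m congexp M u *m v = (M^T *m v)^T *m (exp_diag u *m (M^T *m v)).
  by rewrite trmx_mul trmxK congexp.unlock !mulmxA.
rewrite exp_diag.unlock mul_diag_mx mxE; apply: eq_bigr => i _.
by move: (M^T *m v) => w; rewrite !mxE; ring.
Qed.

Lemma congexp_sym M u : (congexp M u)^T = congexp M u.
Proof. by rewrite congexp.unlock !trmx_mul trmxK tr_exp_diag mulmxA. Qed.

Lemma congexp_posdef M u : M \in unitmx -> posdefmx (congexp M u).
Proof.
move=> Mu; split=> [|v v0]; first exact: congexp_sym.
rewrite quad_congexp.
have ge0 i : true -> 0 <= expR (u 0 i) * (M^T *m v) i 0 ^+ 2.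
  by rewrite mulr_ge0 ?expR_ge0 ?sqr_ge0.
rewrite lt0r sumr_ge0 // andbT psumr_eq0 //; apply: contra v0 => /allP /= w0.
have MTv : M^T *m v = 0.
  apply/matrixP => i j; rewrite (ord1 j) [RHS]mxE.
  by have := w0 i (mem_index_enum i); rewrite mulf_eq0 gt_eqF ?expR_gt0 //= sqrf_eq0 => /eqP.
have MTu : M^T \in unitmx by rewrite unitmx_tr.
by rewrite -(mulKmx MTu v) MTv mulmx0.
Qed.

Lemma orth_unit U : U^T *m U = 1%:M -> U \in unitmx.
Proof. by case/mulmx1_unit. Qed.

Lemma posdef_spectral S : posdefmx S ->
  exists U u, U^T *m U = 1%:M /\ S = congexp U u.
Proof.
move=> [Ssym Spos]; have [U [a [UU SE]]] := spectral_theorem Ssym.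
have a0 i : 0 < a 0 i.
  have ei0 : U *m (delta_mx i 0 : 'cV[R]_d) != 0.
    apply/eqP => /(congr1 (mulmx U^T)); rewrite mulmxA UU mul1mx mulmx0.
    by move=> /matrixP/(_ i 0)/eqP; rewrite !mxE !eqxx oner_eq0.
  have := Spos _ ei0; rewrite SE trmx_mul !mulmxA -(mulmxA _ U^T) UU mulmx1.
  rewrite -(mulmxA _ U^T) UU mulmx1 trmx_delta -rowE -colE.
  by rewrite !mxE eqxx mulr1n.
exists U, (map_mx (@ln R) a); split=> //; rewrite SE congexp.unlock exp_diag.unlock; congr (_ *m diag_mx _ *m _).
by apply/matrixP => i j; rewrite !mxE (ord1 i) lnK // posrE.
Qed.

(** Simultaneous diagonalization: factor G and apply the spectral theorem to the
    whitened H. The vector u is the logarithm of the spectrum of G^-1 H, and every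
    affine-invariant quantity of the pair is a function of u. *)
Lemma posdef_pair G H : posdefmx G -> posdefmx H ->
  exists M u, [/\ M \in unitmx, G = M *m M^T & H = congexp M u].
Proof.
move=> /posdef_spectral[U [u [UU ->]]] Hpos; pose N := U *m exp_diag (2^-1 *: u).
have Nu : N \in unitmx by rewrite unitmx_mul orth_unit ?exp_diag_unit.
have NTu : (invmx N)^T \in unitmx by rewrite unitmx_tr unitmx_inv.
have [|V [v [VV E]]] := @posdef_spectral (invmx N *m H *m (invmx N)^T).
  split=> [|w w0]; first by rewrite /symmx /= !trmx_mul trmxK Hpos.1 mulmxA.
  have := Hpos.2 ((invmx N)^T *m w); rewrite trmx_mul trmxK !mulmxA; apply.
  apply: contra w0 => /eqP/(congr1 (mulmx (invmx (invmx N)^T))).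
  by rewrite mulKmx // mulmx0 => ->.
exists (N *m V), v; split.
- by rewrite unitmx_mul Nu orth_unit.
- by rewrite trmx_mul mulmxA -(mulmxA N) (mulmx1C VV) mulmx1 congexp_base.
by rewrite -congexp_congr -E !mulmxA mulmxV // mul1mx -mulmxA -trmx_mul mulmxV // trmx1 mulmx1.
Qed.

Lemma mulmxT_posdef M : M \in unitmx -> posdefmx (M *m M^T).
Proof. by move=> Mu; rewrite -(congexp0 M); exact: congexp_posdef. Qed.

Lemma invsqrtmxP S : posdefmx S ->
  (invsqrtmx S)^T = invsqrtmx S /\ invsqrtmx S *m S *m invsqrtmx S = 1%:M.
Proof.
move=> /posdef_spectral[U [u [UU ->]]]; rewrite invsqrtmx_congexp //.
split; first exact: congexp_sym.
rewrite !mul_congexp_orth // (_ : _ + _ = 0) ?congexp0 ?(mulmx1C UU) //.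
by apply/matrixP => i j; rewrite !mxE; lra.
Qed.

Lemma invsqrtmx_unit S : posdefmx S -> invsqrtmx S \in unitmx.
Proof. by move=> /invsqrtmxP[_]; rewrite -mulmxA => /mulmx1_unit[]. Qed.

Lemma invsqrtmx_orth M : M \in unitmx ->
  (invsqrtmx (M *m M^T) *m M)^T *m (invsqrtmx (M *m M^T) *m M) = 1%:M.
Proof.
move=> /mulmxT_posdef /invsqrtmxP[sym E]; apply: mulmx1C.
by rewrite trmx_mul sym !mulmxA -(mulmxA _ M).
Qed.

(** The product of the inverse square root of M M^T with M is orthogonal, so the
    whitened matrix is already in spectral form. *)
Lemma whitened_logE M u : M \in unitmx ->
  whitened_log (M *m M^T) (congexp M u) =
  (invsqrtmx (M *m M^T) *m M) *m diag_mx u *m (invsqrtmx (M *m M^T) *m M)^T.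
Proof.
move=> Mu; rewrite /whitened_log.
have [sym _] := invsqrtmxP (mulmxT_posdef Mu).
by rewrite -{2}sym congexp_congr logmx_congexp // invsqrtmx_orth.
Qed.

Lemma dAI_ge0 G H : 0 <= dAI G H.
Proof. exact: sqrtr_ge0. Qed.

Lemma dAI_whitened_log G H : dAI G H = frob_norm (whitened_log G H).
Proof. by []. Qed.

Lemma logmx_whiten G H : whitened_log G H = logmx (invsqrtmx G *m H *m invsqrtmx G).
Proof. by []. Qed.

Lemma congexpE M u i j : congexp M u i j = \sum_k expR (u 0 k) * (M i k * M j k).
Proof.
rewrite congexp.unlock exp_diag.unlock mul_mx_diag mxE; apply: eq_bigr => k _.
by rewrite !mxE; ring.
Qed.

Lemma congexpEdiag M u : congexp M u = M *m exp_diag u *m M^T.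
Proof. by rewrite congexp.unlock. Qed.

End FunctionalCalculus.

Section AffineInvariantDistance.
Context {R : realType} {d : nat}.
Implicit Types (M G H : 'M[R]_d) (u v : 'rV[R]_d).

Lemma dAI_congexp M u v : M \in unitmx ->
  dAI (congexp M u) (congexp M v) ^+ 2 = \sum_i (v 0 i - u 0 i) ^+ 2.
Proof.
move=> Mu; have Nu : M *m exp_diag (2^-1 *: u) \in unitmx.
  by rewrite unitmx_mul Mu exp_diag_unit.
rewrite congexp_base -[in congexp M v](subrKC u v) -congexp_shift dAI_whitened_log whitened_logE //.
rewrite frob_norm_orth ?invsqrtmx_orth // frob_norm_diag.
by apply: eq_bigr => i _; rewrite !mxE.
Qed.

Lemma dAI_base M u : M \in unitmx -> dAI (M *m M^T) (congexp M u) ^+ 2 = \sum_i u 0 i ^+ 2.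
Proof.
move=> Mu; rewrite -(congexp0 M) dAI_congexp //.
by apply: eq_bigr => i _; rewrite mxE subr0.
Qed.

Lemma dAI_sym G H : posdefmx G -> posdefmx H -> dAI G H = dAI H G.
Proof.
move=> Gpos Hpos; have [M [u [Mu -> ->]]] := posdef_pair Gpos Hpos.
apply: (sqr_inj (dAI_ge0 _ _) (dAI_ge0 _ _)).
rewrite -(congexp0 M) (dAI_congexp 0 u Mu) (dAI_congexp u 0 Mu).
by apply: eq_bigr => i _; rewrite -sqrrN opprB.
Qed.

Lemma dAI_congr N G H : N \in unitmx -> posdefmx G -> posdefmx H ->
  dAI (N *m G *m N^T) (N *m H *m N^T) = dAI G H.
Proof.
move=> Nu Gpos Hpos; have [M [u [Mu -> ->]]] := posdef_pair Gpos Hpos.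
apply: (sqr_inj (dAI_ge0 _ _) (dAI_ge0 _ _)).
have NMu : N *m M \in unitmx by rewrite unitmx_mul Nu.
by rewrite -(congexp0 M) !congexp_congr (dAI_congexp _ _ Mu) (dAI_congexp _ _ NMu).
Qed.

Lemma whitened_log_sym G H : posdefmx G -> posdefmx H ->
  (whitened_log G H)^T = whitened_log G H.
Proof.
move=> Gpos Hpos; have [M [u [Mu -> ->]]] := posdef_pair Gpos Hpos.
by rewrite whitened_logE // trmx_mul [(_ *m diag_mx u)^T]trmx_mul tr_diag_mx trmxK mulmxA.
Qed.

End AffineInvariantDistance.

(** * Comparing logarithms in two eigenbases *)

Section ScalarEstimates.
Context {R : realType}.
Implicit Types x : R.

Lemma expR_sub_le x y : expR y - expR x <= (y - x) * expR y.
Proof.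
have : (1 + (x - y)) * expR y <= expR (x - y) * expR y.
  by rewrite ler_pM2r ?expR_gt0 ?expR_ge1Dx.
by rewrite -expRD subrK; lra.
Qed.

(** The function 4 sinh(x/2)^2. *)
Definition chord x : R := expR x + expR (- x) - 2.

Lemma chordE x : chord x = expR (- x) * (expR x - 1) ^+ 2.
Proof.
have := expRxMexpNx_1 x; rewrite /chord => e.
transitivity (expR x * (expR x * expR (- x)) - 2 * (expR x * expR (- x)) + expR (- x)).
  by rewrite e; ring.
by ring.
Qed.

Lemma chord_le x : chord x <= x ^+ 2 * expR `|x|.
Proof.
wlog x0 : x / 0 <= x => [W|].
  have [/W//|/ltW x0] := leP 0 x.
  have := W (- x); rewrite oppr_ge0 normrN sqrrN => /(_ x0).
  by rewrite /chord opprK (addrC (expR _)).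
rewrite ger0_norm // chordE.
have e1 : 0 <= expR x - 1 by rewrite subr_ge0 -expR0 ler_expR.
have e2 : expR x - 1 <= x * expR x.
  by have := expR_sub_le 0 x; rewrite expR0 subr0.
have -> : x ^+ 2 * expR x = expR (- x) * (x * expR x) ^+ 2.
  transitivity (x ^+ 2 * expR x * (expR x * expR (- x))); last by ring.
  by rewrite expRxMexpNx_1 mulr1.
by rewrite ler_wpM2l ?expR_ge0 // lerXn2r // nnegrE // (le_trans e1).
Qed.

(** The difference of the two sides vanishes at 0 and has derivative
    exp c + exp (- c) - 2 >= 0. *)
Lemma le_sinh2 x : 0 <= x -> 2 * x <= expR x - expR (- x).
Proof.
move=> x0; pose f (y : R) := expR y - expR (- y).
have fE (y : R) : is_derive y 1 f (expR y + expR (- y)).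
  by apply: is_derive_eq; rewrite mulrN1 opprK.
have fc : {within `[0, x], continuous f}.
  by apply: derivable_within_continuous => y _; exact: ex_derive.
have [c _] := MVT_segment x0 (fun y _ => fE y) fc.
rewrite subr0 /f oppr0 subrr subr0 => ->; rewrite ler_wpM2r //.
by have := expR_ge1Dx c; have := expR_ge1Dx (- c); lra.
Qed.

(** It is [le_sinh2] at x / 2, squared. *)
Lemma sqr_le_chord x : x ^+ 2 <= chord x.
Proof.
wlog x0 : x / 0 <= x => [W|].
  have [/W//|/ltW x0] := leP 0 x.
  have := W (- x); rewrite oppr_ge0 sqrrN => /(_ x0).
  by rewrite /chord opprK (addrC (expR (- x))).
have chord_double h : chord (h + h) = (expR h - expR (- h)) ^+ 2.
  by rewrite /chord opprD !expRD sqrrB expRxMexpNx_1; ring.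
rewrite [in leRHS](splitr x) chord_double.
have := @le_sinh2 (x / 2); rewrite (mulrC 2) divfK ?pnatr_eq0 // divr_ge0 // => /(_ isT) h.
by rewrite lerXn2r // nnegrE (le_trans x0 h).
Qed.

End ScalarEstimates.

Section ExponentialMetricIncreasing.
Context {R : realType} {d : nat}.
Implicit Types (M G H S T U V A B C : 'M[R]_d) (u v x y : 'rV[R]_d).

(** Multiplying by U^T on the left and V on the right preserves the Frobenius norm and turns
    the difference into the matrix with entries (x_i - y_j) W_ij, where W = U^T V. *)
Lemma frob_norm_mixed_bases U V x y : U^T *m U = 1%:M -> V^T *m V = 1%:M ->
  frob_norm (U *m diag_mx x *m U^T - V *m diag_mx y *m V^T) ^+ 2 =
  \sum_i \sum_j (U^T *m V) i j ^+ 2 * (x 0 i - y 0 j) ^+ 2.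
Proof.
move=> UU VV; set W := U^T *m V.
have -> : U *m diag_mx x *m U^T - V *m diag_mx y *m V^T =
    U *m (diag_mx x *m W - W *m diag_mx y) *m V^T.
  have -> : U^T = W *m V^T by rewrite /W -mulmxA (mulmx1C VV) mulmx1.
  rewrite mulmxBr mulmxBl !mulmxA.
  by rewrite (mulmx1C UU) mul1mx.
rewrite frob_norm_orth // frob_norm_sqrE; apply: eq_bigr => i _; apply: eq_bigr => j _.
rewrite mul_diag_mx mul_mx_diag; move: W => W; rewrite !mxE; ring.
Qed.

Lemma mxtrace_congexp U V x y :
  \tr (congexp U x *m congexp V y) =
  \sum_i \sum_j (U^T *m V) i j ^+ 2 * expR (x 0 i + y 0 j).
Proof.
rewrite !congexpEdiag -!mulmxA mxtrace_mulC -!mulmxA.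
have -> : V^T *m U = (U^T *m V)^T by rewrite trmx_mul trmxK.
rewrite (mulmxA U^T); move: (U^T *m V) => W.
rewrite exp_diag.unlock /mxtrace; apply: eq_bigr => i _.
rewrite mul_diag_mx mxE mxE mxE mulr_sumr; apply: eq_bigr => j _.
by rewrite mul_diag_mx !mxE expRD; ring.
Qed.

Lemma invmx_congexp U x : U^T *m U = 1%:M -> invmx (congexp U x) = congexp U (- x).
Proof.
move=> UU; have E : congexp U x *m congexp U (- x) = 1%:M.
  by rewrite mul_congexp_orth // subrr congexp0 (mulmx1C UU).
have [Xu _] := mulmx1_unit E.
by rewrite -[RHS](mulKmx Xu) E mulmx1.
Qed.

Lemma mxtrace_pencil M u : M \in unitmx ->
  \tr (congexp M u *m invmx (M *m M^T)) = \sum_i expR (u 0 i) /\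
  \tr ((M *m M^T) *m invmx (congexp M u)) = \sum_i expR (- u 0 i).
Proof.
move=> Mu; have MTu : M^T \in unitmx by rewrite unitmx_tr.
have trE (v : 'rV[R]_d) : \tr (exp_diag v) = \sum_i expR (v 0 i).
  by rewrite exp_diag.unlock mxtrace_diag; apply: eq_bigr => i _; rewrite mxE.
have invM A B : A \in unitmx -> B \in unitmx -> invmx (A *m B) = invmx B *m invmx A.
  move=> Au Bu; have ABu : A *m B \in unitmx by rewrite unitmx_mul Au.
  have E : (A *m B) *m (invmx B *m invmx A) = 1%:M.
    by rewrite mulmxA -(mulmxA A) mulmxV // mulmx1 mulmxV.
  by rewrite -[RHS](mulKmx ABu) E mulmx1.
split.
  rewrite invM // congexpEdiag !mulmxA -(mulmxA _ M^T) mulmxV // mulmx1.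
  by rewrite mxtrace_mulC !mulmxA mulVmx // mul1mx trE.
have invE : invmx (exp_diag u) = exp_diag (- u).
  by rewrite -[RHS](mulKmx (exp_diag_unit u)) exp_diagD subrr exp_diag0 mulmx1.
have Eu := exp_diag_unit u.
rewrite congexpEdiag invM ?unitmx_mul ?Mu // invM // invE !mulmxA -(mulmxA _ M^T) mulmxV //.
rewrite mulmx1 mxtrace_mulC !mulmxA mulVmx // mul1mx trE.
by apply: eq_bigr => i _; rewrite mxE.
Qed.

(** Both sides are tr (S T^-1) + tr (T S^-1) - 2 d for S = congexp U x and T = congexp V y,
    computed once from the two spectral decompositions and once from the simultaneous
    diagonalization; the constant 2 d is twice the squared norm of the orthogonal U^T V. *)
Lemma chord_mixed_bases U V x y M u :
  U^T *m U = 1%:M -> V^T *m V = 1%:M -> M \in unitmx ->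
  congexp U x = congexp M u -> congexp V y = M *m M^T ->
  \sum_i \sum_j (U^T *m V) i j ^+ 2 * chord (x 0 i - y 0 j) = \sum_i chord (u 0 i).
Proof.
move=> UU VV Mu SE TE; have [t1 t2] := mxtrace_pencil u Mu.
rewrite -SE -TE invmx_congexp // mxtrace_congexp in t1.
rewrite -SE -TE invmx_congexp // mxtrace_mulC mxtrace_congexp in t2.
have WW : \sum_i \sum_j (U^T *m V) i j ^+ 2 * 2 = \sum_(i < d) (2 : R).
  under eq_bigr do rewrite -mulr_suml; rewrite -mulr_suml.
  have WW1 : frob_norm (U^T *m V) ^+ 2 = frob_norm (1%:M : 'M[R]_d) ^+ 2.
    rewrite -{1}[V]trmxK -[X in X *m _]mulmx1 frob_norm_orth //.
      by rewrite trmxK (mulmx1C UU).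
    by rewrite trmxK (mulmx1C VV).
  rewrite -frob_norm_sqrE WW1 frob_norm_sqr /frob_dot trmx1 mulmx1 mxtrace1.
  by rewrite sumr_const card_ord mulr_natl.
rewrite /chord big_split sumrN /= -WW big_split /= -t1 -t2 -!big_split /= -sumrB.
apply: eq_bigr => i _; rewrite -!big_split -sumrB /=; apply: eq_bigr => j _.
by rewrite !mxE opprB (addrC (- x 0 i)); ring.
Qed.

End ExponentialMetricIncreasing.

(** * Nonpositive curvature of the affine-invariant metric *)

Section NonpositiveCurvature.
Context {R : realType} {d : nat}.
Implicit Types (M G H S T A B C : 'M[R]_d) (u v x y : 'rV[R]_d).

Lemma frob_log_le_chord M u : M \in unitmx ->
  frob_norm (logmx (congexp M u) - logmx (M *m M^T)) ^+ 2 <= \sum_i chord (u 0 i).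
Proof.
move=> Mu; have [U [x [UU SE]]] := posdef_spectral (congexp_posdef u Mu).
have [V [y [VV TE]]] := posdef_spectral (mulmxT_posdef Mu).
rewrite -(chord_mixed_bases UU VV Mu (esym SE) (esym TE)) SE TE !logmx_congexp //.
rewrite frob_norm_mixed_bases //; apply: ler_sum => i _; apply: ler_sum => j _.
by rewrite ler_wpM2l ?sqr_ge0 ?sqr_le_chord.
Qed.

Lemma frob_norm_sqrD_le A B :
  frob_norm (A + B) ^+ 2 <= 2 * frob_norm A ^+ 2 + 2 * frob_norm B ^+ 2.
Proof.
rewrite !frob_norm_sqrE !mulr_sumr -big_split; apply: ler_sum => i _ /=.
rewrite !mulr_sumr -big_split; apply: ler_sum => j _ /=; rewrite mxE.
by rewrite -subr_ge0 (_ : _ - _ = (A i j - B i j) ^+ 2) ?sqr_ge0 //; ring.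
Qed.

(** As |A + B|^2 <= 2 |A|^2 + 2 |B|^2, a bound c on the squared displacement of the logarithm over
    each half of a geodesic gives the bound 4 c over the whole of it; p halvings replace u
    by u / 2^p at the cost of a factor 4^p. *)
Lemma frob_log_le_dyadic p M u : M \in unitmx ->
  frob_norm (logmx (congexp M u) - logmx (M *m M^T)) ^+ 2 * (2^-1 ^+ p) ^+ 2 <=
  \sum_i chord (2^-1 ^+ p * u 0 i).
Proof.
elim: p M u => [|p IH] M u Mu.
  rewrite expr0 expr1n mulr1; under eq_bigr do rewrite mul1r.
  exact: frob_log_le_chord.
pose h : 'rV[R]_d := 2^-1 *: u; pose N := M *m exp_diag (2^-1 *: h).
have Nu : N \in unitmx by rewrite unitmx_mul Mu exp_diag_unit.
have uE : u = h + h by rewrite /h -scalerDl (_ : 2^-1 + 2^-1 = 1) ?scale1r //; lra.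
have NE : N *m N^T = congexp M h by rewrite -congexp_base.
have SE : congexp M u = congexp N h by rewrite /N congexp_shift -uE.
have := IH N h Nu; have := IH M h Mu; rewrite NE -SE.
set X := logmx (congexp M u); set Y := logmx (congexp M h); set Z := logmx (M *m M^T).
have -> : X - Z = (X - Y) + (Y - Z) by rewrite addrA subrK.
have := frob_norm_sqrD_le (X - Y) (Y - Z).
have -> : \sum_i chord (2^-1 ^+ p * h 0 i) = \sum_i chord (2^-1 ^+ p.+1 * u 0 i).
  by apply: eq_bigr => i _; rewrite /h mxE exprSr mulrA.
rewrite [2^-1 ^+ p.+1]exprSr exprMn; have := sqr_ge0 (2^-1 ^+ p : R).
move: (frob_norm _ ^+ 2) (frob_norm (X - Y) ^+ 2) (frob_norm (Y - Z) ^+ 2).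
move: (\sum_i _) ((2^-1 ^+ p) ^+ 2) => s q n1 n2 n3 q0 n123 i1 i2.
have : n1 * q <= (2 * n2 + 2 * n3) * q by rewrite ler_wpM2r.
by lra.
Qed.

(** The dyadic bound is at most (sum_i u_i^2) exp (2^-p c), where c bounds every |u_i|;
    let p tend to infinity. *)
Lemma frob_log_le_dAI S T : posdefmx S -> posdefmx T ->
  frob_norm (logmx S - logmx T) ^+ 2 <= dAI T S ^+ 2.
Proof.
move=> Spos Tpos; have [M [u [Mu TE SE]]] := posdef_pair Tpos Spos.
rewrite TE SE dAI_base //; set X := frob_norm _ ^+ 2; set D := \sum_i _.
pose c := \sum_i `|u 0 i|.
have uc i : `|u 0 i| <= c by rewrite /c (bigD1 i) //= lerDl sumr_ge0.
have half_lt1 : `|2^-1 : R| < 1 by rewrite ger0_norm //; lra.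
have lim : (fun p => D * expR (2^-1 ^+ p * c)) @ \oo --> D * expR (0 * c).
  apply: cvgM; first exact: cvg_cst.
  apply: continuous_cvg; first exact: continuous_expR.
  by apply: cvgM; [exact: cvg_expr|exact: cvg_cst].
have -> : D = D * expR (0 * c) by rewrite mul0r expR0 mulr1.
apply: (cvgr_to_ge lim); apply: nearW => p.
have q0 : 0 < (2^-1 ^+ p : R) by rewrite exprn_gt0.
rewrite -(ler_pM2r (exprn_gt0 2 q0)); apply: (le_trans (frob_log_le_dyadic p u Mu)).
rewrite /D !mulr_suml; apply: ler_sum => i _; apply: (le_trans (chord_le _)).
set E := expR `|_|.
rewrite -[leRHS]mulrA (_ : _ * E = u 0 i ^+ 2 * (E * (2^-1 ^+ p) ^+ 2)); last by ring.
apply: ler_wpM2l; first exact: sqr_ge0.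
apply: ler_wpM2r; first exact: sqr_ge0.
by rewrite ler_expR normrM (gtr0_norm q0) ler_wpM2l // ltW.
Qed.

(** The converse of [frob_log_le_dAI] on bounded sets, by the opposite estimate of the
    chord function in the same identity; it yields the continuity of the exponential. *)
Lemma dAI_le_frob_log S T : posdefmx S -> posdefmx T ->
  dAI T S ^+ 2 <=
  expR (frob_norm (logmx S) + frob_norm (logmx T)) * frob_norm (logmx S - logmx T) ^+ 2.
Proof.
move=> Spos Tpos; have [M [u [Mu TM SM]]] := posdef_pair Tpos Spos.
have [U [x [UU SE]]] := posdef_spectral Spos.
have [V [y [VV TE]]] := posdef_spectral Tpos.
have E := chord_mixed_bases UU VV Mu (etrans (esym SE) SM) (etrans (esym TE) TM).
have le_norm (Q : 'M[R]_d) (z : 'rV[R]_d) i : Q^T *m Q = 1%:M ->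
    `|z 0 i| <= frob_norm (Q *m diag_mx z *m Q^T).
  move=> QQ; have := abs_entry_le_frob (diag_mx z) i i; rewrite !mxE eqxx mulr1n.
  by rewrite (sqr_inj (frob_norm_ge0 _) (frob_norm_ge0 _) (frob_norm_orth (diag_mx z) QQ QQ)).
rewrite {1}TM {1}SM dAI_base // SE TE !logmx_congexp //.
rewrite frob_norm_mixed_bases // mulr_sumr.
apply: le_trans (_ : \sum_i chord (u 0 i) <= _).
  by apply: ler_sum => i _; exact: sqr_le_chord.
rewrite -E; apply: ler_sum => i _; rewrite mulr_sumr; apply: ler_sum => j _.
rewrite mulrCA; apply: ler_wpM2l; first exact: sqr_ge0.
apply: (le_trans (chord_le _)); rewrite mulrC; apply: ler_wpM2r; first exact: sqr_ge0.
rewrite ler_expR; apply: (le_trans (ler_normB _ _)).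
by apply: lerD; exact: le_norm.
Qed.

(** Whitening by B is a congruence, hence an isometry, so the case B = 1 suffices. *)
Lemma frob_whitened_log_le_dAI B A C : posdefmx B -> posdefmx A -> posdefmx C ->
  frob_norm (whitened_log B A - whitened_log B C) ^+ 2 <= dAI A C ^+ 2.
Proof.
move=> Bpos Apos Cpos; have [Wsym _] := invsqrtmxP Bpos; have Wu := invsqrtmx_unit Bpos.
have whiten_posdef X : posdefmx X -> posdefmx (invsqrtmx B *m X *m invsqrtmx B).
  move=> /posdef_spectral[U [u [UU ->]]]; rewrite -{2}Wsym congexp_congr.
  by apply: congexp_posdef; rewrite unitmx_mul Wu orth_unit.
rewrite !logmx_whiten (le_trans (frob_log_le_dAI (whiten_posdef _ Apos) (whiten_posdef _ Cpos))) //.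
by rewrite -{2 4}Wsym (dAI_congr Wu Cpos Apos) (dAI_sym Cpos Apos).
Qed.

(** Seen from one of its points a geodesic is a straight line, run at constant speed. *)
Lemma whitened_log_geodesic M u t : M \in unitmx ->
  exists L : 'M[R]_d, frob_norm L ^+ 2 = dAI (M *m M^T) (congexp M u) ^+ 2 /\
   forall s, whitened_log (congexp M (t *: u)) (congexp M (s *: u)) = (s - t) *: L.
Proof.
move=> Mu; pose N := M *m exp_diag (2^-1 *: (t *: u)).
have Nu : N \in unitmx by rewrite unitmx_mul Mu exp_diag_unit.
pose Q := invsqrtmx (N *m N^T) *m N.
exists (Q *m diag_mx u *m Q^T); split.
  by rewrite frob_norm_orth ?invsqrtmx_orth // frob_norm_diag dAI_base.
move=> s; rewrite congexp_base -/N -[s *: u](subrKC (t *: u)) -congexp_shift -/N.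
rewrite whitened_logE // -scalerBl linearZ /= -/Q.
by rewrite -scalemxAr -scalemxAl.
Qed.

(** Take the intermediate point as base point. The geodesic becomes a segment s |-> (s - t) L,
    the logarithm contracts the two sides issuing from H, and the inequality becomes
    the parallelogram identity in the Euclidean space of symmetric matrices. *)
Lemma dAI_geodesic_cat0 M u H t : M \in unitmx -> posdefmx H -> 0 <= t <= 1 ->
  dAI H (congexp M (t *: u)) ^+ 2 <=
  (1 - t) * dAI H (M *m M^T) ^+ 2 + t * dAI H (congexp M u) ^+ 2 -
  t * (1 - t) * dAI (M *m M^T) (congexp M u) ^+ 2.
Proof.
move=> Mu Hpos /andP[t0 t1].
have [L [<- Llog]] := whitened_log_geodesic u t Mu.
have Bpos := congexp_posdef (t *: u) Mu.
have LA := Llog 0; rewrite scale0r congexp0 sub0r in LA.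
have LC := Llog 1; rewrite scale1r in LC.
have dA := frob_whitened_log_le_dAI Bpos Hpos (mulmxT_posdef Mu).
have dC := frob_whitened_log_le_dAI Bpos Hpos (congexp_posdef u Mu).
rewrite LA scaleNr opprK frob_norm_sqrDZ in dA.
rewrite LC -scaleNr frob_norm_sqrDZ in dC.
rewrite (dAI_sym Hpos Bpos) dAI_whitened_log.
move: dA dC; set r := frob_norm _ ^+ 2; set n := frob_norm L ^+ 2; set f := frob_dot _ _.
set a := dAI _ _ ^+ 2; set c := dAI _ _ ^+ 2 => dA dC.
have : (1 - t) * (r + 2 * t * f + t ^+ 2 * n) <= (1 - t) * a.
  by apply: ler_wpM2l; rewrite ?subr_ge0.
have : t * (r + 2 * - (1 - t) * f + (- (1 - t)) ^+ 2 * n) <= t * c by apply: ler_wpM2l.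
set p := t * c; set q := (1 - t) * a; move=> i1 i2.
have := lerD i2 i1; rewrite -subr_ge0 => i3; rewrite -subr_ge0; congr (0 <= _): i3.
ring.
Qed.

(** The left-hand side of the CAT(0) inequality is nonnegative; optimizing over the time
    leaves the triangle inequality. *)
Lemma dAI_triangle A C H : posdefmx A -> posdefmx C -> posdefmx H ->
  dAI A C <= dAI H A + dAI H C.
Proof.
move=> Apos Cpos Hpos; have [M [u [Mu AE CE]]] := posdef_pair Apos Cpos.
have cat0 t : 0 <= t <= 1 ->
    t * (1 - t) * dAI A C ^+ 2 <= (1 - t) * dAI H A ^+ 2 + t * dAI H C ^+ 2.
  move=> /(dAI_geodesic_cat0 u Mu Hpos); rewrite -AE -CE => h.
  by have := sqr_ge0 (dAI H (congexp M (t *: u))); lra.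
move: cat0; move: (dAI_ge0 H A) (dAI_ge0 H C) (dAI_ge0 A C).
move: (dAI H A) (dAI H C) (dAI A C) => a b c a0 b0 c0 cat0.
(* The optimal time is a / (a + b); enlarging both sides by e keeps it inside ]0, 1[. *)
apply/ler_addgt0Pr => e2 e2_gt0; pose e := e2 / 2.
have e0 : 0 < e by rewrite divr_gt0.
have a'0 : 0 < a + e by lra.
have b'0 : 0 < b + e by lra.
have -> : a + b + e2 = (a + e) + (b + e) by rewrite /e; lra.
have le_a' : a ^+ 2 <= (a + e) ^+ 2 by rewrite lerXn2r ?nnegrE //; lra.
have le_b' : b ^+ 2 <= (b + e) ^+ 2 by rewrite lerXn2r ?nnegrE //; lra.
move: (a + e) (b + e) a'0 b'0 le_a' le_b' => x y x0 y0 le_ax le_by.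
have xy0 : 0 < x + y by rewrite addr_gt0.
have t01 : 0 <= x / (x + y) <= 1.
  by rewrite divr_ge0 ?(ltW x0) ?(ltW xy0) //= ler_pdivrMr // mul1r lerDl ltW.
have t'E : 1 - x / (x + y) = y / (x + y) by field; rewrite gt_eqF.
have := cat0 _ t01; rewrite t'E => h.
have {}h : x / (x + y) * (y / (x + y)) * c ^+ 2 <= y / (x + y) * x ^+ 2 + x / (x + y) * y ^+ 2.
  by apply: (le_trans h); apply: lerD; apply: ler_wpM2l; rewrite ?divr_ge0 // ltW.
rewrite -(@ler_pXn2r _ 2) ?nnegrE ?(ltW xy0) //.
have k0 : 0 < x / (x + y) * (y / (x + y)) by rewrite mulr_gt0 // divr_gt0.
rewrite -(ler_pM2l k0); apply: (le_trans h); rewrite le_eqVlt; apply/orP; left; apply/eqP.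
by field; rewrite gt_eqF.
Qed.

End NonpositiveCurvature.

(** * The Kronecker family and its log-Kronecker directions *)

Section KroneckerFamily.
Context {R : realType} {m n : nat}.
Implicit Types (Z W L G H : 'M[R]_(n * m)).

Lemma mxtens_index_eq (i k : 'I_n) (j l : 'I_m) :
  (mxtens_index (i, j) == mxtens_index (k, l)) = (i == k) && (j == l).
Proof. by rewrite (can_eq (@mxtens_indexK n m)) xpair_eqE. Qed.

Lemma sum_mxtens (F : 'I_(n * m) -> R) :
  \sum_p F p = \sum_i \sum_j F (mxtens_index (i, j)).
Proof.
rewrite pair_big /= (reindex (@mxtens_index n m)) /=; last first.
  by exists (@mxtens_unindex n m) => p _; rewrite (mxtens_indexK, mxtens_unindexK).
by apply: eq_bigr => -[i j] _.
Qed.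

Lemma tensmx1 : tensmx (1%:M : 'M[R]_n) (1%:M : 'M[R]_m) = 1%:M.
Proof.
apply/matrixP => p q; case: (mxtens_indexP p) => i j; case: (mxtens_indexP q) => k l.
by rewrite tensmxE !mxE mxtens_index_eq; case: eqP; case: eqP; rewrite ?mulr0 ?mul0r ?mulr1.
Qed.

Lemma tensmx_unitmx (N : 'M[R]_n) (M : 'M[R]_m) : N \in unitmx -> M \in unitmx ->
  tensmx N M \in unitmx.
Proof.
move=> Nu Mu; have : tensmx N M *m tensmx (invmx N) (invmx M) = 1%:M.
  by rewrite tensmx_mul !mulmxV // tensmx1.
by case/mulmx1_unit.
Qed.

Lemma tensmx_orth (U : 'M[R]_n) (V : 'M[R]_m) : U^T *m U = 1%:M -> V^T *m V = 1%:M ->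
  (tensmx U V)^T *m tensmx U V = 1%:M.
Proof. by move=> UU VV; rewrite trmx_tens tensmx_mul UU VV tensmx1. Qed.

(** The diagonal of [diag_mx b] (x) 1 + 1 (x) [diag_mx a]. *)
Definition tens_sum (b : 'rV[R]_n) (a : 'rV[R]_m) : 'rV[R]_(n * m) :=
  \row_p (b 0 (mxtens_unindex p).1 + a 0 (mxtens_unindex p).2).

Lemma tens_sumZ t b a : t *: tens_sum b a = tens_sum (t *: b) (t *: a).
Proof. by apply/matrixP => i j; rewrite !mxE mulrDr. Qed.

Lemma diag_tens_sum b a : diag_mx (tens_sum b a) =
  tensmx 1%:M (diag_mx a) + tensmx (diag_mx b) 1%:M.
Proof.
apply/matrixP => p q; case: (mxtens_indexP p) => i j; case: (mxtens_indexP q) => k l.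
rewrite [RHS]mxE !tensmxE !mxE mxtens_index_eq mxtens_indexK /=.
by case: eqP => [->|]; case: eqP => [->|]; rewrite ?mulr0n ?mulr1n ?mulr0 ?mul0r ?mulr1 ?mul1r ?addr0 // addrC.
Qed.

Lemma tens_exp_diag b a : tensmx (exp_diag b) (exp_diag a) = exp_diag (tens_sum b a).
Proof.
rewrite !exp_diag.unlock.
apply/matrixP => p q; case: (mxtens_indexP p) => i j; case: (mxtens_indexP q) => k l.
rewrite !tensmxE !mxE mxtens_index_eq mxtens_indexK /= expRD.
by case: eqP => [->|]; case: eqP => [->|]; rewrite ?mulr0n ?mulr1n ?mulr0 ?mul0r.
Qed.

Lemma tens_congexp (N : 'M[R]_n) (M : 'M[R]_m) b a :
  tensmx (congexp N b) (congexp M a) = congexp (tensmx N M) (tens_sum b a).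
Proof. by rewrite !congexpEdiag trmx_tens -tens_exp_diag !tensmx_mul. Qed.

Lemma kron_congexp (N : 'M[R]_n) (M : 'M[R]_m) b a : N \in unitmx -> M \in unitmx ->
  kron_family m n (congexp (tensmx N M) (tens_sum b a)).
Proof.
move=> Nu Mu; exists (congexp M a), (congexp N b).
by split; [exact: congexp_posdef|exact: congexp_posdef|rewrite tens_congexp].
Qed.

(** Diagonalizing the two pairs of factors simultaneously diagonalizes the Kronecker
    products, with the log-spectrum of a Kronecker product being the sum of those of its factors. *)
Lemma kron_family_pair G H : kron_family m n G -> kron_family m n H ->
  exists (N : 'M[R]_n) (M : 'M[R]_m) b a,
  [/\ N \in unitmx, M \in unitmx, G = tensmx N M *m (tensmx N M)^T &
      H = congexp (tensmx N M) (tens_sum b a)].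
Proof.
move=> [A [B [Apos Bpos ->]]] [A' [B' [A'pos B'pos ->]]].
have [M [a [Mu -> ->]]] := posdef_pair Apos A'pos.
have [N [b [Nu -> ->]]] := posdef_pair Bpos B'pos.
exists N, M, b, a; split=> //; last by rewrite tens_congexp.
by rewrite trmx_tens tensmx_mul.
Qed.

Lemma kron_posdef G : kron_family m n G -> posdefmx G.
Proof.
move=> Gkron; have [N [M [b [a [Nu Mu -> _]]]]] := kron_family_pair Gkron Gkron.
exact: mulmxT_posdef (tensmx_unitmx Nu Mu).
Qed.

(** Geodesic convexity: real powers of products b_i a_j are products of powers. *)
Lemma kron_family_geodesic G H : kron_family m n G -> kron_family m n H ->
  exists M u, [/\ M \in unitmx, G = M *m M^T, H = congexp M u &
                  forall t, kron_family m n (congexp M (t *: u))].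
Proof.
move=> Gk Hk; have [N [M [b [a [Nu Mu -> ->]]]]] := kron_family_pair Gk Hk.
exists (tensmx N M), (tens_sum b a); split=> // [|t]; first exact: tensmx_unitmx.
by rewrite tens_sumZ; exact: kron_congexp.
Qed.

Lemma kron_familyZ (c : R) G : 0 < c -> kron_family m n G -> kron_family m n (c *: G).
Proof.
move=> c0 [A [B [Apos [Bsym Bpos] ->]]]; exists A, (c *: B); split=> //.
  split; first by rewrite /symmx /= linearZ /= Bsym.
  by move=> v v0; rewrite -scalemxAr -scalemxAl mxE mulr_gt0 ?Bpos.
by apply/matrixP => p q; rewrite !mxE mulrA.
Qed.

Lemma log_kron_diag (U : 'M[R]_n) (V : 'M[R]_m) b a :
  U^T *m U = 1%:M -> V^T *m V = 1%:M ->
  tensmx U V *m diag_mx (tens_sum b a) *m (tensmx U V)^T =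
  tensmx 1%:M (V *m diag_mx a *m V^T) + tensmx (U *m diag_mx b *m U^T) 1%:M.
Proof.
move=> /mulmx1C UU /mulmx1C VV.
by rewrite diag_tens_sum mulmxDr mulmxDl trmx_tens !tensmx_mul !mulmx1 UU VV.
Qed.

Lemma log_kron_spectral (U : 'M[R]_n) (V : 'M[R]_m) b a :
  U^T *m U = 1%:M -> V^T *m V = 1%:M ->
  log_kron m n (tensmx U V *m diag_mx (tens_sum b a) *m (tensmx U V)^T).
Proof.
move=> UU VV; rewrite log_kron_diag //.
exists (V *m diag_mx a *m V^T), (U *m diag_mx b *m U^T).
by split=> //; rewrite /symmx /= !trmx_mul trmxK tr_diag_mx mulmxA.
Qed.

Lemma logmx_kron G : kron_family m n G -> log_kron m n (logmx G).
Proof.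
move=> [A [B [/posdef_spectral[V [a [VV ->]]] /posdef_spectral[U [b [UU ->]]] ->]]].
by rewrite tens_congexp logmx_congexp ?tensmx_orth //; exact: log_kron_spectral.
Qed.

Lemma log_kron_logmx Z : log_kron m n Z -> exists2 G, kron_family m n G & logmx G = Z.
Proof.
move=> [X [Y [/spectral_theorem[V [a [VV ->]]] /spectral_theorem[U [b [UU ->]]] ->]]].
exists (congexp (tensmx U V) (tens_sum b a)); first by apply: kron_congexp; exact: orth_unit.
by rewrite logmx_congexp ?tensmx_orth // log_kron_diag.
Qed.

Lemma invsqrtmx_tens (B : 'M[R]_n) (A : 'M[R]_m) : posdefmx B -> posdefmx A ->
  invsqrtmx (tensmx B A) = tensmx (invsqrtmx B) (invsqrtmx A).
Proof.
move=> /posdef_spectral[U [b [UU ->]]] /posdef_spectral[V [a [VV ->]]].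
by rewrite tens_congexp !invsqrtmx_congexp ?tensmx_orth // tens_congexp tens_sumZ.
Qed.

(** The inverse square root of a Kronecker product is the product of the inverse square
    roots, so the orthogonal frame of the whitened pair is itself a Kronecker product. *)
Lemma whitened_log_kron G H : kron_family m n G -> kron_family m n H ->
  log_kron m n (whitened_log G H).
Proof.
move=> Gk Hk; have [N [M [b [a [Nu Mu -> ->]]]]] := kron_family_pair Gk Hk.
have E : tensmx N M *m (tensmx N M)^T = tensmx (N *m N^T) (M *m M^T).
  by rewrite trmx_tens tensmx_mul.
rewrite whitened_logE ?tensmx_unitmx // E invsqrtmx_tens; try exact: mulmxT_posdef.
by rewrite tensmx_mul; apply: log_kron_spectral; exact: invsqrtmx_orth.
Qed.

Definition ptrace_left Z : 'M[R]_m :=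
  \matrix_(j, l) \sum_i Z (mxtens_index (i, j)) (mxtens_index (i, l)).

Definition ptrace_right Z : 'M[R]_n :=
  \matrix_(i, k) \sum_j Z (mxtens_index (i, j)) (mxtens_index (k, j)).

Lemma sum_diag1 (d : nat) (F : 'I_d -> R) i : \sum_k F k * (i == k)%:R = F i.
Proof.
rewrite (bigD1 i) //= big1 => [|k ki]; first by rewrite eqxx mulr1 addr0.
by rewrite eq_sym (negbTE ki) mulr0.
Qed.

Lemma frob_dot_ptrace_left Z X : frob_dot Z (tensmx 1%:M X) = frob_dot (ptrace_left Z) X.
Proof.
rewrite !frob_dotE sum_mxtens exchange_big /=; apply: eq_bigr => j _.
transitivity (\sum_i \sum_l Z (mxtens_index (i, j)) (mxtens_index (i, l)) * X j l).
  apply: eq_bigr => i _; rewrite sum_mxtens exchange_big /=; apply: eq_bigr => l _.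
  rewrite -(sum_diag1 (fun k => Z (mxtens_index (i, j)) (mxtens_index (k, l)) * X j l)).
  by apply: eq_bigr => k _; rewrite tensmxE mxE; ring.
rewrite exchange_big /=; apply: eq_bigr => l _.
by rewrite mxE mulr_suml.
Qed.

Lemma frob_dot_ptrace_right Z Y : frob_dot Z (tensmx Y 1%:M) = frob_dot (ptrace_right Z) Y.
Proof.
rewrite !frob_dotE sum_mxtens; apply: eq_bigr => i _.
transitivity (\sum_j \sum_k Z (mxtens_index (i, j)) (mxtens_index (k, j)) * Y i k).
  apply: eq_bigr => j _; rewrite sum_mxtens; apply: eq_bigr => k _.
  rewrite -(sum_diag1 (fun l => Z (mxtens_index (i, j)) (mxtens_index (k, l)) * Y i k)).
  by apply: eq_bigr => l _; rewrite tensmxE mxE; ring.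
rewrite exchange_big /=; apply: eq_bigr => k _.
by rewrite mxE mulr_suml.
Qed.

Lemma ptrace_left_log_kron X Y :
  ptrace_left (tensmx 1%:M X + tensmx Y 1%:M) = n%:R *: X + (\tr Y)%:M.
Proof.
apply/matrixP => j l; rewrite !mxE.
under eq_bigr => i _ do rewrite mxE !tensmxE !mxE eqxx mul1r.
rewrite big_split /= sumr_const card_ord mulr_natl; congr (_ + _).
by rewrite -mulr_suml mulr_natr.
Qed.

Lemma ptrace_right_log_kron X Y :
  ptrace_right (tensmx 1%:M X + tensmx Y 1%:M) = (\tr X)%:M + m%:R *: Y.
Proof.
apply/matrixP => i k; rewrite !mxE.
under eq_bigr => j _ do rewrite mxE !tensmxE !mxE eqxx mulr1.
rewrite big_split /= sumr_const card_ord [m%:R * _]mulr_natl; congr (_ + _).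
by rewrite -mulr_sumr mulr_natl.
Qed.

Lemma mxtrace_ptrace Z : \tr (ptrace_left Z) = \tr (ptrace_right Z).
Proof.
rewrite /mxtrace; under eq_bigr do rewrite mxE; under [RHS]eq_bigr do rewrite mxE.
exact: exchange_big.
Qed.

(** The partial traces are adjoint to the two embeddings, so orthogonality to the subspace
    means that both partial traces of the residual vanish. This linear system is solved
    by the normalized partial traces, with the trace counted once. *)
Lemma log_kron_projP Z : (0 < m)%N -> (0 < n)%N -> Z^T = Z ->
  log_kron m n (log_kron_proj Z) /\
  forall L, log_kron m n L -> frob_dot (Z - log_kron_proj Z) L = 0.
Proof.
move=> m0 n0 Zsym.
have m0' : m%:R != 0 :> R by rewrite pnatr_eq0 -lt0n.
have n0' : n%:R != 0 :> R by rewrite pnatr_eq0 -lt0n.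
set tau := \tr (ptrace_left Z).
pose X := n%:R^-1 *: ptrace_left Z.
pose Y := m%:R^-1 *: ptrace_right Z - (tau / (n%:R * m%:R))%:M.
pose W := tensmx 1%:M X + tensmx Y 1%:M.
have trX : \tr X = tau / n%:R by rewrite mxtraceZ mulrC.
have trY : \tr Y = 0.
  rewrite raddfB /= mxtraceZ mxtrace_scalar -mxtrace_ptrace -/tau -mulr_natr.
  by field; rewrite m0' n0'.
have Wl : ptrace_left W = ptrace_left Z.
  by rewrite ptrace_left_log_kron trY scalerA divff // scale1r raddf0 addr0.
have Wr : ptrace_right W = ptrace_right Z.
  rewrite ptrace_right_log_kron trX scalerBr scalerA divff // scale1r scale_scalar_mx.
  have -> : m%:R * (tau / (n%:R * m%:R)) = tau / n%:R by field; rewrite m0' n0'.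
  by rewrite addrCA subrr addr0.
apply: (@xgetPex _ 0 [set W | log_kron m n W /\
   forall L, log_kron m n L -> frob_dot (Z - W) L = 0]).
exists W; split.
  exists X, Y; split=> //.
    rewrite /symmx /= linearZ /=; congr (_ *: _); apply/matrixP => j l; rewrite !mxE.
    by apply: eq_bigr => i _; rewrite -{1}Zsym mxE.
  rewrite /symmx /= linearB /= linearZ /= tr_scalar_mx; congr (_ *: _ - _).
  by apply/matrixP => i k; rewrite !mxE; apply: eq_bigr => j _; rewrite -{1}Zsym mxE.
move=> _ [X' [Y' [_ _ ->]]].
rewrite -scaleN1r frob_dotDl frob_dotZl !frob_dotDr.
by rewrite !frob_dot_ptrace_left !frob_dot_ptrace_right Wl Wr; ring.
Qed.

End KroneckerFamily.

(** * Projection onto the Kronecker family *)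

Section KroneckerProjection.
Context {R : realType} {m n : nat}.
Context (m_gt0 : (0 < m)%N) (n_gt0 : (0 < n)%N).
Implicit Types (Z L G H P : 'M[R]_(n * m)).

Lemma log_kron_sym Z : log_kron m n Z -> Z^T = Z.
Proof.
move=> [X [Y [Xsym Ysym ->]]].
by rewrite linearD /= !trmx_tens !trmx1 Xsym Ysym.
Qed.

Lemma frob_pythagoras Z L : Z^T = Z -> log_kron m n L ->
  frob_norm (Z - L) ^+ 2 =
  frob_norm (Z - log_kron_proj Z) ^+ 2 + frob_norm (log_kron_proj Z - L) ^+ 2.
Proof.
move=> Zsym Lk; have [Wk ortho] := log_kron_projP m_gt0 n_gt0 Zsym.
set W := log_kron_proj Z in Wk ortho *.
have -> : Z - L = (Z - W) + 1 *: (W - L) by rewrite scale1r addrA subrK.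
by rewrite frob_norm_sqrDZ -(scaleN1r L) frob_dotDr frob_dotZr !ortho //; ring.
Qed.

Lemma frob_norm_log_kron_proj Z : Z^T = Z ->
  frob_norm Z ^+ 2 =
  frob_norm (Z - log_kron_proj Z) ^+ 2 + frob_norm (log_kron_proj Z) ^+ 2.
Proof.
move=> Zsym; have [Wk ortho] := log_kron_projP m_gt0 n_gt0 Zsym.
set W := log_kron_proj Z in Wk ortho *.
by rewrite -{1}(subrK W Z) -[X in _ + X]scale1r frob_norm_sqrDZ !ortho //; ring.
Qed.

(** The contraction at base point G sends G' into the log-Kronecker subspace, whose
    distance to the whitened logarithm of H is the norm of the residual. *)
Lemma frob_whitened_residual_le_dAI H G G' : posdefmx H ->
  kron_family m n G -> kron_family m n G' ->
  frob_norm (whitened_log G H - log_kron_proj (whitened_log G H)) ^+ 2 <= dAI H G' ^+ 2.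
Proof.
move=> Hpos Gk G'k; have [Gpos G'pos] := (kron_posdef Gk, kron_posdef G'k).
apply: le_trans (frob_whitened_log_le_dAI Gpos Hpos G'pos).
have Rsym := whitened_log_sym Gpos Hpos.
by rewrite (frob_pythagoras Rsym (whitened_log_kron Gk G'k)) lerDl sqr_ge0.
Qed.

Lemma has_inf_dAI_kron H G : kron_family m n G ->
  has_inf [set dAI H G | G in kron_family m n].
Proof.
move=> Gk; split; first by exists (dAI H G), G.
by exists 0 => _ [G' _ <-]; exact: dAI_ge0.
Qed.

Lemma dAI_set_ge0 H G : kron_family m n G -> 0 <= dAI_set H (kron_family m n).
Proof.
move=> Gk; apply: lb_le_inf; first exact: (has_inf_dAI_kron H Gk).1.
by move=> _ [G' _ <-]; exact: dAI_ge0.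
Qed.

Lemma dAI_set_le H G : kron_family m n G -> dAI_set H (kron_family m n) <= dAI H G.
Proof.
by move=> Gk; apply: ge_inf; [exact: (has_inf_dAI_kron H Gk).2|exists G].
Qed.

(** The midpoint of G and G' stays in the family, so its distance to H is at least the
    infimum; the CAT(0) inequality then makes minimizing sequences Cauchy. *)
Lemma dAI_kron_midpoint H G G' : posdefmx H -> kron_family m n G -> kron_family m n G' ->
  dAI G G' ^+ 2 <= 2 * dAI H G ^+ 2 + 2 * dAI H G' ^+ 2 -
                   4 * dAI_set H (kron_family m n) ^+ 2.
Proof.
move=> Hpos Gk G'k; have [M [u [Mu GE G'E geo]]] := kron_family_geodesic Gk G'k.
have half01 : 0 <= (2^-1 : R) <= 1 by apply/andP; split; lra.
have := dAI_geodesic_cat0 u Mu Hpos half01; rewrite -GE -G'E.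
have : dAI_set H (kron_family m n) ^+ 2 <= dAI H (congexp M (2^-1 *: u)) ^+ 2.
  by rewrite lerXn2r ?nnegrE ?(dAI_set_ge0 _ Gk) ?dAI_ge0 // dAI_set_le.
lra.
Qed.

Lemma cauchy_seq_cvg (x : nat -> R) :
  (forall e, 0 < e -> exists N, forall k, (N <= k)%N -> `|x N - x k| < e) -> cvgn x.
Proof.
move=> xcauchy; apply/cauchy_cvgP; apply: cauchy_exP => e /xcauchy[N xN].
by exists (x N), N.
Qed.

Lemma cauchy_mx_cvg (d : nat) (X : nat -> 'M[R]_d) :
  (forall k, (X k)^T = X k) ->
  (forall e, 0 < e -> exists N, forall k, (N <= k)%N -> frob_norm (X N - X k) < e) ->
  exists L : 'M[R]_d, L^T = L /\ (fun k => frob_norm (X k - L) ^+ 2) @ \oo --> (0 : R).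
Proof.
move=> Xsym Xcauchy; have Xij i j : cvgn (fun k => X k i j).
  apply: cauchy_seq_cvg => e /Xcauchy[N XN]; exists N => k /XN; apply: le_lt_trans.
  by have := abs_entry_le_frob (X N - X k) i j; rewrite !mxE.
pose L : 'M[R]_d := \matrix_(i, j) limn (fun k => X k i j).
exists L; split.
  apply/matrixP => i j; rewrite !mxE; congr (limn _).
  by apply/funext => k; rewrite -{1}Xsym mxE.
have -> : (fun k => frob_norm (X k - L) ^+ 2) =
          (fun k => \sum_i \sum_j (X k i j - L i j) ^+ 2).
  apply/funext => k; rewrite frob_norm_sqrE; apply: eq_bigr => i _.
  by apply: eq_bigr => j _; rewrite !mxE.
have zero : \sum_(i < d) \sum_(j < d) (L i j - L i j) ^+ 2 = 0.
  by rewrite big1 // => i _; rewrite big1 // => j _; rewrite subrr expr0n.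
suff : (fun k => \sum_i \sum_j (X k i j - L i j) ^+ 2) @ \oo -->
    \sum_(i < d) \sum_(j < d) (L i j - L i j) ^+ 2 by rewrite zero.
apply: (cvg_big (@add_continuous R)) => i _.
apply: (cvg_big (@add_continuous R)) => j _.
rewrite expr2; under eq_fun do rewrite expr2.
have XL : (fun k => X k i j - L i j) @ \oo --> L i j - L i j.
  by apply: cvgB; [rewrite mxE; exact: Xij|exact: cvg_cst].
exact: (cvgM XL XL).
Qed.

(** A minimizing sequence is Cauchy for d, hence its logarithms are Cauchy and converge
    to some L. Instead of showing that the limit stays in the log-Kronecker subspace, L is
    replaced by its projection V, which is at least as close to every term of the
    sequence. The exponential of V belongs to the family, and it is the d-limit of
    the sequence. *)
Theorem kron_proj_exists H : posdefmx H ->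
  exists2 P, kron_family m n P & forall G, kron_family m n G -> dAI H P <= dAI H G.
Proof.
move=> Hpos; set K := kron_family m n; set delta := dAI_set H K.
have K1 : K (tensmx 1%:M 1%:M).
  have pos1 (d : nat) : posdefmx (1%:M : 'M[R]_d).
    by have := @mulmxT_posdef R d 1%:M; rewrite trmx1 mulmx1 unitmx1; apply.
  by exists 1%:M, 1%:M; split.
have approx (k : nat) : exists G, K G /\ dAI H G < delta + k.+1%:R^-1.
  have k0 : 0 < k.+1%:R^-1 :> R by rewrite invr_gt0 ltr0n.
  by have [_ [G GK <-] lt] := inf_adherent k0 (has_inf_dAI_kron H K1); exists G.
have [G_ G_P] := choice approx; have GK k : K (G_ k) := (G_P k).1.
have delta0 : 0 <= delta := dAI_set_ge0 H K1.
pose eps (k : nat) : R := k.+1%:R^-1.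
have eps01 k : 0 < eps k <= 1.
  by rewrite invr_gt0 ltr0n /= invf_le1 ?ltr0n // ler1n.
have eps_le j k : (j <= k)%N -> eps k <= eps j.
  by move=> jk; rewrite lef_pV2 ?posrE ?ltr0n // ler_nat.
have eps_small e : 0 < e -> exists N, forall k, (N <= k)%N -> eps k < e.
  move=> e0; have [N _ NP] := near_infty_natSinv_lt (PosNum e0).
  by exists N => k Nk; exact: NP.
(* From d(H, G_k) <= delta + eps k and eps k <= 1. *)
pose C := 4 * (2 * delta + 1).
have C0 : 0 < C by rewrite /C; lra.
have dG j k : (j <= k)%N -> dAI (G_ j) (G_ k) ^+ 2 <= C * eps j.
  move=> jk; apply: (le_trans (dAI_kron_midpoint Hpos (GK j) (GK k))).
  have bound i : dAI H (G_ i) ^+ 2 <= delta ^+ 2 + (2 * delta + 1) * eps i.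
    have /ltW le_i := (G_P i).2; have /andP[e0 e1] := eps01 i.
    have : dAI H (G_ i) ^+ 2 <= (delta + eps i) ^+ 2.
      by rewrite lerXn2r ?nnegrE ?dAI_ge0 // addr_ge0 // ltW.
    have : eps i ^+ 2 <= eps i by rewrite expr2 ler_piMr // ltW.
    by rewrite sqrrD; move: (delta ^+ 2) (eps i ^+ 2) => ? ?; lra.
  have := bound j; have := bound k; have := eps_le _ _ jk.
  rewrite -/K -/delta /C -(ler_pM2l (_ : 0 < 2 * delta + 1)); last by lra.
  by move: (dAI H _ ^+ 2) (dAI H _ ^+ 2) (delta ^+ 2) => ? ? ?; lra.
pose X k := logmx (G_ k).
have Xkron k : log_kron m n (X k) := logmx_kron (GK k).
have [||L [Lsym XL]] := @cauchy_mx_cvg _ X; first by move=> k; exact: log_kron_sym.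
  move=> e e0; have [|N NP] := eps_small (e ^+ 2 / C); first by rewrite divr_gt0 ?exprn_gt0.
  exists N => k Nk; rewrite -(@ltr_pXn2r _ 2) ?nnegrE ?frob_norm_ge0 ?(ltW e0) //.
  apply: (le_lt_trans (frob_log_le_dAI (kron_posdef (GK N)) (kron_posdef (GK k)))).
  rewrite (dAI_sym (kron_posdef (GK k)) (kron_posdef (GK N))).
  by apply: (le_lt_trans (dG _ _ Nk)); rewrite mulrC -ltr_pdivlMr // NP.
have [Vkron _] := log_kron_projP m_gt0 n_gt0 Lsym; set V := log_kron_proj L in Vkron.
have [P PK PV] := log_kron_logmx Vkron; exists P => // G GK'.
apply: le_trans (_ : delta <= _); last exact: dAI_set_le.
have XV k : frob_norm (X k - V) ^+ 2 <= frob_norm (X k - L) ^+ 2.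
  rewrite -(frob_norm_sqrN (X k - L)) -(frob_norm_sqrN (X k - V)) !opprB.
  by rewrite (frob_pythagoras Lsym (Xkron k)) lerDr sqr_ge0.
(* Once X k is within 1 of L, |X k|^2 <= 2 + 2 |V|^2, and |X k| <= 1 + |X k|^2. *)
pose B := expR (3 + 2 * frob_norm V ^+ 2 + frob_norm V).
have dPG k : frob_norm (X k - L) ^+ 2 <= 1 ->
    dAI (G_ k) P ^+ 2 <= B * frob_norm (X k - L) ^+ 2.
  move=> le1; rewrite (dAI_sym (kron_posdef (GK k)) (kron_posdef PK)).
  apply: (le_trans (dAI_le_frob_log (kron_posdef (GK k)) (kron_posdef PK))).
  rewrite PV; apply: ler_pM; [exact: expR_ge0|exact: sqr_ge0| |exact: XV].
  rewrite ler_expR lerD2r.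
  have := frob_norm_sqrD_le (X k - V) V; rewrite subrK; have := XV k.
  have := sqr_ge0 (frob_norm V); have := sqr_ge0 (frob_norm (X k) - 1); rewrite sqrrB1 -/(X k).
  by move: (frob_norm (X k - V) ^+ 2) (frob_norm (X k - L) ^+ 2) le1 (frob_norm V ^+ 2)
     (frob_norm (X k) ^+ 2) => a b b1 c e; lra.
apply/ler_addgt0Pr => e e0; have e20 : 0 < e / 2 by rewrite divr_gt0.
have [N1 N1P] := eps_small _ e20.
have B0 : 0 < B by exact: expR_gt0.
(* Below 1 the bound [dPG] applies, and below the second value it is at most (e / 2)^2. *)
pose r := Num.min 1 ((e / 2) ^+ 2 / B).
have r0 : 0 < r by rewrite lt_min ltr01 divr_gt0 // exprn_gt0.
have [N2 _ N2P] := cvgr0_norm_lt _ XL _ r0.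
pose k := maxn N1 N2; have := N2P k (leq_maxr _ _).
rewrite /= ger0_norm ?sqr_ge0 // lt_min => /andP[/ltW lt1 ltB].
have le2 : dAI (G_ k) P <= e / 2.
  rewrite -(@ler_pXn2r _ 2) ?nnegrE ?dAI_ge0 ?(ltW e20) //.
  apply: (le_trans (dPG k lt1)); rewrite mulrC -ler_pdivlMr //; exact: ltW.
have /ltW le1 : dAI H (G_ k) < delta + e / 2.
  by apply: (lt_trans (G_P k).2); rewrite ltrD2l N1P // leq_maxl.
apply: (le_trans (dAI_triangle Hpos (kron_posdef PK) (kron_posdef (GK k)))).
by rewrite (dAI_sym (kron_posdef (GK k)) Hpos); lra.
Qed.

Lemma kron_projP H : posdefmx H -> kron_family m n (kron_proj H) /\
  forall G, kron_family m n G -> dAI H (kron_proj H) <= dAI H G.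
Proof.
move=> /kron_proj_exists[P PK Pmin].
apply: (@xgetPex _ 0 [set P | kron_family m n P /\
  forall G, kron_family m n G -> dAI H P <= dAI H G]).
by exists P.
Qed.

(** Minimality of P along the geodesic from P to G, inserted in the CAT(0) inequality at
    time t, gives (1 - t) d(P, G)^2 <= d(H, G)^2 - d(H, P)^2; let t tend to 0. *)
Lemma dAI_kron_proj_pythagoras H G : posdefmx H -> kron_family m n G ->
  dAI H (kron_proj H) ^+ 2 + dAI G (kron_proj H) ^+ 2 <= dAI H G ^+ 2.
Proof.
move=> Hpos Gk; have [Pk Pmin] := kron_projP Hpos; set P := kron_proj H in Pk Pmin *.
rewrite (dAI_sym (kron_posdef Gk) (kron_posdef Pk)).
have [M [u [Mu PE GE geo]]] := kron_family_geodesic Pk Gk.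
have cat0 t : 0 < t <= 1 -> (1 - t) * dAI P G ^+ 2 <= dAI H G ^+ 2 - dAI H P ^+ 2.
  move=> /andP[t0 t1]; have t01 : 0 <= t <= 1 by rewrite (ltW t0).
  have := dAI_geodesic_cat0 u Mu Hpos t01; rewrite -PE -GE.
  have : dAI H P ^+ 2 <= dAI H (congexp M (t *: u)) ^+ 2.
    by rewrite lerXn2r ?nnegrE ?dAI_ge0 // Pmin.
  move=> i1 i2; rewrite -(ler_pM2l t0); move: i1 i2.
  move: (dAI _ _ ^+ 2) (dAI _ _ ^+ 2) (dAI _ _ ^+ 2) (dAI _ _ ^+ 2) => a b c f; lra.
move: cat0; move: (dAI H G ^+ 2) (dAI H P ^+ 2) => b a cat0.
have : 0 <= dAI P G ^+ 2 by exact: sqr_ge0.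
move: (dAI P G ^+ 2) cat0 => c cat0 c0; rewrite leNgt; apply/negP => lt_c.
have ba : 0 <= b - a by have := cat0 1; rewrite subrr mul0r ltr01 lexx; apply.
have c_gt0 : 0 < c by lra.
(* At this time (1 - t) c is the midpoint of c and b - a, which exceeds b - a. *)
have t01 : 0 < (c - (b - a)) / (2 * c) <= 1.
  by rewrite divr_gt0 ?mulr_gt0 //=; [rewrite ler_pdivrMr ?mulr_gt0 //; lra|lra].
have := cat0 _ t01; have -> : (1 - (c - (b - a)) / (2 * c)) * c = (c + (b - a)) / 2.
  by field; rewrite gt_eqF.
lra.
Qed.

(** With L the whitened logarithm of P at G, the Pythagorean inequality and the contraction
    give |L|^2 <= <R, L> = <V, L>, hence |L| <= |V|. *)
Lemma dAI_kron_proj_le H G : posdefmx H -> kron_family m n G ->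
  dAI G (kron_proj H) <= frob_norm (log_kron_proj (whitened_log G H)).
Proof.
move=> Hpos Gk; have [Pk _] := kron_projP Hpos.
have := dAI_kron_proj_pythagoras Hpos Gk; set P := kron_proj H in Pk *.
have [Gpos Ppos] := (kron_posdef Gk, kron_posdef Pk).
have Rsym := whitened_log_sym Gpos Hpos.
have Lk := whitened_log_kron Gk Pk.
have := frob_whitened_log_le_dAI Gpos Hpos Ppos.
rewrite (dAI_sym Hpos Gpos) !(dAI_whitened_log G).
have [_ ortho] := log_kron_projP m_gt0 n_gt0 Rsym.
move: (whitened_log G P) Lk => L Lk; move: (whitened_log G H) ortho Rsym => Z ortho Rsym.
have VL := ortho L Lk; set V := log_kron_proj Z in VL *.
rewrite -(scaleN1r V) frob_dotDl frob_dotZl in VL.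
have := sqr_ge0 (frob_norm (V - L)); rewrite -(scaleN1r L) !frob_norm_sqrDZ.
move=> i1 i2 i3; rewrite -(@ler_pXn2r _ 2) ?nnegrE ?frob_norm_ge0 //.
move: VL i1 i2 i3; move: (dAI H P ^+ 2) (frob_norm Z ^+ 2) (frob_norm L ^+ 2) (frob_norm V ^+ 2).
by move=> a b c e; lra.
Qed.

End KroneckerProjection.

(** * Condition numbers of pencils *)

Section ConditionNumber.
Context {R : realType} {d : nat}.
Implicit Types (M G H S : 'M[R]_d) (u : 'rV[R]_d) (E : set R).

Lemma sup_max E (x : R) : E x -> ubound E x -> sup E = x.
Proof.
move=> Ex ubx; apply/eqP; rewrite eq_le; apply/andP; split.
  by apply: ge_sup => //; exists x.
by apply: ub_le_sup => //; exists x.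
Qed.

Lemma inf_min E (x : R) : E x -> lbound E x -> inf E = x.
Proof.
move=> Ex lbx; apply/eqP; rewrite eq_le; apply/andP; split.
  by apply: ge_inf => //; exists x.
by apply: lb_le_inf => //; exists x.
Qed.

Lemma gen_eigenvalue_congexp M u l : M \in unitmx ->
  gen_eigenvalue (M *m M^T) (congexp M u) l <-> exists i, l = expR (u 0 i).
Proof.
move=> Mu; have MTu : M^T \in unitmx by rewrite unitmx_tr.
rewrite /gen_eigenvalue congexpEdiag; split=> [[v v0]|[i ->]].
  rewrite -!mulmxA scalemxAr => /(can_inj (mulKmx Mu)).
  have w0 : M^T *m v != 0 by apply: contra v0 => /eqP E; rewrite -(mulKmx MTu v) E mulmx0.
  move: (M^T *m v) w0 => w w0; rewrite exp_diag.unlock mul_diag_mx => E.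
  have /existsP[i wi] : [exists i, w i 0 != 0].
    apply: contraR w0; rewrite negb_exists => /forallP w_eq0; apply/eqP/matrixP => i j.
    by rewrite (ord1 j) [RHS]mxE; have := w_eq0 i; rewrite negbK => /eqP.
  exists i; have /matrixP/(_ i 0) := E; rewrite !mxE => /eqP.
  by rewrite (inj_eq (mulIf wi)) => /eqP ->.
have e0 : (delta_mx i 0 : 'cV[R]_d) != 0.
  by apply/eqP => /matrixP/(_ i 0)/eqP; rewrite !mxE !eqxx oner_eq0.
exists (invmx M^T *m delta_mx i 0).
  by apply: contra e0 => /eqP E; rewrite -(mulKVmx MTu (delta_mx i 0)) E mulmx0.
rewrite -!mulmxA !(mulKVmx MTu) scalemxAr; congr (_ *m _).
rewrite exp_diag.unlock mul_diag_mx; apply/matrixP => k c; rewrite !mxE.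
by case: eqP => [->//|_]; rewrite !mulr0.
Qed.

Lemma kappa_pencil_congexp M u : (0 < d)%N -> M \in unitmx ->
  exists i j, [/\ forall k, u 0 k <= u 0 i, forall k, u 0 j <= u 0 k &
    kappa_pencil (M *m M^T) (congexp M u) = expR (u 0 i - u 0 j)].
Proof.
move=> d0 Mu; pose i0 := Ordinal d0.
pose i := [arg max_(k > i0) u 0 k]%O; pose j := [arg min_(k < i0) u 0 k]%O.
have ui k : u 0 k <= u 0 i by rewrite /i; case: arg_maxP => // p _; apply.
have uj k : u 0 j <= u 0 k by rewrite /j; case: arg_minP => // p _; apply.
exists i, j; split=> //; rewrite /kappa_pencil.
rewrite (_ : [set l | _] = [set l | exists k, l = expR (u 0 k)]); last first.
  by apply/seteqP; split=> l /(gen_eigenvalue_congexp u l Mu).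
rewrite (@sup_max _ (expR (u 0 i))); last 2 first.
- by exists i.
- by move=> _ [k ->]; rewrite ler_expR.
rewrite (@inf_min _ (expR (u 0 j))); first by rewrite expRD expRN.
- by exists j.
by move=> _ [k ->]; rewrite ler_expR.
Qed.

Lemma kappa_pencil_ge1 G H : (0 < d)%N -> posdefmx G -> posdefmx H -> 1 <= kappa_pencil G H.
Proof.
move=> d0 Gpos Hpos; have [M [u [Mu -> ->]]] := posdef_pair Gpos Hpos.
have [i [j [ui _ ->]]] := kappa_pencil_congexp u d0 Mu.
by rewrite -expR0 ler_expR subr_ge0.
Qed.

Definition quad S (v : 'cV[R]_d) : R := (v^T *m S *m v) 0 0.

Lemma quad_mulmxT M v : quad (M *m M^T) v = \sum_i (M^T *m v) i 0 ^+ 2.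
Proof.
rewrite /quad -congexp0 quad_congexp; apply: eq_bigr => i _.
by rewrite mxE expR0 mul1r.
Qed.

Lemma quad_congexp_between M u (a b : R) v : (forall i, a <= u 0 i <= b) ->
  expR a * quad (M *m M^T) v <= quad (congexp M u) v <= expR b * quad (M *m M^T) v.
Proof.
move=> uab; rewrite quad_mulmxT /quad quad_congexp !mulr_sumr.
by apply/andP; split; apply: ler_sum => i _; apply: ler_wpM2r; rewrite ?sqr_ge0 // ler_expR;
  have /andP[] := uab i.
Qed.

(** With [kappa_pencil_le], this characterizes the condition number of a pencil by two-sided bounds
    on quadratic forms, which compose when the base point changes. *)
Lemma kappa_pencil_quad G H : (0 < d)%N -> posdefmx G -> posdefmx H ->
  exists2 l, 0 < l &
  forall v, l * quad G v <= quad H v <= kappa_pencil G H * l * quad G v.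
Proof.
move=> d0 Gpos Hpos; have [M [u [Mu -> ->]]] := posdef_pair Gpos Hpos.
have [i [j [ui uj ->]]] := kappa_pencil_congexp u d0 Mu.
exists (expR (u 0 j)) => [|v]; first exact: expR_gt0.
rewrite -expRD subrK; apply: quad_congexp_between => k.
by rewrite uj ui.
Qed.

Lemma kappa_pencil_le G H k l : (0 < d)%N -> posdefmx G -> posdefmx H -> 0 < l ->
  (forall v, l * quad G v <= quad H v <= k * l * quad G v) -> kappa_pencil G H <= k.
Proof.
move=> d0 Gpos Hpos l0; have [M [u [Mu -> ->]]] := posdef_pair Gpos Hpos.
have [i [j [ui uj ->]]] := kappa_pencil_congexp u d0 Mu.
have MTu : M^T \in unitmx by rewrite unitmx_tr.
move=> bound; have between p : l <= expR (u 0 p) <= k * l.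
  have sum_delta (F : 'I_d -> R) : \sum_q F q * (delta_mx p 0 : 'cV[R]_d) q 0 ^+ 2 = F p.
    rewrite (bigD1 p) //= big1 => [|q qp]; first by rewrite mxE !eqxx expr1n mulr1 addr0.
    by rewrite mxE (negbTE qp) expr0n mulr0.
  have := bound (invmx M^T *m delta_mx p 0).
  rewrite quad_mulmxT /quad quad_congexp mulKVmx // sum_delta.
  by under eq_bigr do rewrite -[_ ^+ 2]mul1r; rewrite sum_delta !mulr1.
have /andP[lj _] := between j; have /andP[_ ik] := between i.
have k0 : 0 <= k.
  by rewrite -(pmulr_lge0 _ l0) (le_trans _ ik) // expR_ge0.
rewrite expRD expRN ler_pdivrMr ?expR_gt0 // (le_trans ik) //.
exact: ler_wpM2l.
Qed.

Lemma kappa_pencil_lipschitz G P H eta : (0 < d)%N ->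
  posdefmx G -> posdefmx P -> posdefmx H -> dAI G P <= eta ->
  kappa_pencil P H <= expR (2 * eta) * kappa_pencil G H.
Proof.
move=> d0 Gpos Ppos Hpos le_eta.
have GP v : expR (- eta) * quad G v <= quad P v <= expR eta * quad G v.
  have [M [u [Mu GE PE]]] := posdef_pair Gpos Ppos.
  have ueta i : - eta <= u 0 i <= eta.
    rewrite -ler_norml (le_trans _ le_eta) // -(@ler_pXn2r _ 2) ?nnegrE ?dAI_ge0 //.
    rewrite GE PE dAI_base // -normrX ger0_norm ?sqr_ge0 // (bigD1 i) //= lerDl.
    by rewrite sumr_ge0 // => k _; exact: sqr_ge0.
  by rewrite GE PE; exact: quad_congexp_between.
have [l l0 GH] := kappa_pencil_quad d0 Gpos Hpos.
apply: (@kappa_pencil_le _ _ _ (l * expR (- eta))) => //.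
  by rewrite mulr_gt0 ?expR_gt0.
have e1 : expR eta * expR (- eta) = 1 by rewrite expRxMexpNx_1.
have k1 : 0 <= kappa_pencil G H * l.
  by rewrite mulr_ge0 ?(ltW l0) // (le_trans ler01) ?kappa_pencil_ge1.
move=> v; have /andP[g1 g2] := GH v; have /andP[p1 p2] := GP v.
apply/andP; split.
  apply: le_trans g1; rewrite -mulrA; apply: ler_wpM2l (ltW l0) _ _ _.
  by rewrite expRN ler_pdivrMl ?expR_gt0.
apply: (le_trans g2).
have -> : expR (2 * eta) * kappa_pencil G H * (l * expR (- eta)) * quad P v =
    kappa_pencil G H * l * (expR eta * quad P v) * (expR eta * expR (- eta)).
  by rewrite mulr_natl mulr2n expRD; ring.
rewrite e1 mulr1; apply: ler_wpM2l => //.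
by rewrite -ler_pdivrMl ?expR_gt0 // -expRN.
Qed.

(** Eigenvectors of a matrix are rows and those of a pencil are columns; symmetry exchanges them. *)
Lemma kappa_symmx S : S^T = S -> kappa S = kappa_pencil 1%:M S.
Proof.
move=> Ssym; rewrite /kappa /kappa_pencil.
suff -> : [set l | eigenvalue S l] = [set l | gen_eigenvalue 1%:M S l] by [].
apply/seteqP; split=> l /=.
  move=> /eigenvalueP[v vS v0]; exists v^T; first by rewrite trmx_eq0.
  by rewrite mul1mx -{1}Ssym -trmx_mul vS linearZ.
move=> [v v0]; rewrite mul1mx => Sv; apply/eigenvalueP; exists v^T; last by rewrite trmx_eq0.
by rewrite -{1}Ssym -trmx_mul Sv linearZ.
Qed.

(** Whitening G by H inverts the spectrum of G^-1 H, which preserves the ratio of the extremes. *)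
Lemma kappa_whiten G H : (0 < d)%N -> posdefmx G -> posdefmx H ->
  posdefmx (invsqrtmx H *m G *m invsqrtmx H) /\
  kappa (invsqrtmx H *m G *m invsqrtmx H) = kappa_pencil G H.
Proof.
move=> d0 Gpos Hpos; have [Wsym _] := invsqrtmxP Hpos.
have [M [u [Mu GE HE]]] := posdef_pair Gpos Hpos.
pose N := M *m exp_diag (2^-1 *: u); have Nu : N \in unitmx.
  by rewrite unitmx_mul Mu exp_diag_unit.
have HN : H = N *m N^T by rewrite HE congexp_base.
pose U := invsqrtmx H *m N.
have UU : U^T *m U = 1%:M by rewrite /U HN invsqrtmx_orth.
have SE : invsqrtmx H *m G *m invsqrtmx H = congexp U (- u).
  by rewrite -{2}Wsym GE -congexp0 -(subrr u) -congexp_shift congexp_congr.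
have Uu := orth_unit UU.
split; first by rewrite SE; exact: congexp_posdef.
rewrite SE kappa_symmx ?congexp_sym // -(mulmx1C UU) GE HE.
have [i [j [ui uj ->]]] := kappa_pencil_congexp u d0 Mu.
have [p [q [up uq ->]]] := kappa_pencil_congexp (- u) d0 Uu.
have Nmx k : (- u) 0 k = - u 0 k by rewrite mxE.
have ei : u 0 q = u 0 i.
  by apply/le_anti; rewrite ui /= -lerN2 -!Nmx uq.
have ej : u 0 p = u 0 j.
  by apply/le_anti; rewrite uj andbT -lerN2 -!Nmx up.
by rewrite !Nmx ei ej opprK addrC.
Qed.

End ConditionNumber.

(** * Popoviciu's variance bound *)

Section VarianceBound.
Context {R : realType}.

(** The left-hand side is N sum x^2 - (sum x)^2 for the values xs together with k ones and p zeros.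
    It is convex in each value, so the head of xs may be moved to 0 or to 1;
    once all values are 0 or 1 it is k p, at most floor((k + p)^2 / 4) by AM-GM. *)
Lemma popoviciu_seq (xs : seq R) (k p : nat) :
  all (fun x => 0 <= x <= 1) xs ->
  (k + p + size xs)%:R * (k%:R + \sum_(x <- xs) x ^+ 2) - (k%:R + \sum_(x <- xs) x) ^+ 2
  <= ((k + p + size xs) ^ 2 %/ 4)%:R :> R.
Proof.
elim: xs k p => [|t xs IH] k p /=.
  move=> _; rewrite !big_nil !addr0 addn0 natrD.
  rewrite (_ : _ - _ = (k * p)%:R); last by rewrite natrM; ring.
  rewrite ler_nat leq_divRL // mulnC; exact: nat_AGM2.
move=> /andP[/andP[t0 t1] xs01].
have IH0 := IH k p.+1 xs01; have IH1 := IH k.+1 p xs01.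
rewrite !big_cons; rewrite !addnS addSn in IH0 IH1 *.
move: (\sum_(x <- xs) x ^+ 2) (\sum_(x <- xs) x) IH0 IH1 => q s IH0 IH1.
have N1 : 1 <= (k + p + size xs).+1%:R :> R by rewrite ler1n.
rewrite -[k.+1%:R]natr1 in IH1.
move: (_ %/ _)%:R (k + p + size xs).+1%:R k%:R IH0 IH1 N1 => F N K IH0 IH1 N1.
have t'0 : 0 <= 1 - t by rewrite subr_ge0.
have conv : 0 <= (N - 1) * (t * (1 - t)) by rewrite !mulr_ge0 ?subr_ge0.
have h := lerD (ler_wpM2l t'0 IH0) (ler_wpM2l t0 IH1).
lra.
Qed.

(** The witness is the mean. Working with the exact extremal count, rather than with the
    continuous bound s^2 / 4 on the variance, gives the integer part. *)
Lemma popoviciu (d : nat) (f : 'I_d -> R) (l s : R) : (0 < d)%N ->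
  (forall i, l <= f i <= l + s) ->
  exists c, d%:R * \sum_i (f i - c) ^+ 2 <= (d ^ 2 %/ 4)%:R * s ^+ 2.
Proof.
move=> d0 fls; have [s0|s_neq0] := eqVneq s 0.
  exists l; rewrite big1 ?mulr0 ?s0 ?expr0n ?mulr0 // => i _.
  have := fls i; rewrite s0 addr0 => /le_anti <-.
  by rewrite subrr expr0n.
have s_gt0 : 0 < s.
  by have /andP[h1 h2] := fls (Ordinal d0); rewrite lt0r s_neq0 -(lerD2l l) addr0 (le_trans h1).
pose x i := (f i - l) / s; pose xs := [seq x i | i <- enum 'I_d].
have dneq0 : d%:R != 0 :> R by rewrite pnatr_eq0 -lt0n.
have xs01 : all (fun x => 0 <= x <= 1) xs.
  apply/allP => _ /mapP[i _ ->]; have /andP[h1 h2] := fls i.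
  by rewrite /x divr_ge0 ?subr_ge0 ?(ltW s_gt0) //= ler_pdivrMr // mul1r lerBlDl.
have := popoviciu_seq 0 0 xs01.
rewrite /xs size_map size_enum_ord !add0n !add0r !big_map -!enumT !big_enum /= => h.
set m1 := \sum_i x i in h; exists (l + s * (m1 / d%:R)).
have fE i : (f i - (l + s * (m1 / d%:R))) ^+ 2 =
    s ^+ 2 * x i ^+ 2 - s ^+ 2 * (2 * m1 / d%:R) * x i + s ^+ 2 * (m1 / d%:R) ^+ 2.
  have -> : f i = l + s * x i by rewrite /x mulrC divfK // addrC subrK.
  ring.
under eq_bigr do rewrite fE.
rewrite big_split sumrB /= -!mulr_sumr -/m1 sumr_const card_ord -[_ *+ d]mulr_natl.
move: h; set q := \sum_i _; set F := (_ %/ _)%:R => h.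
apply: le_trans (ler_wpM2r (sqr_ge0 s) h); rewrite le_eqVlt; apply/orP; left; apply/eqP.
by field.
Qed.

End VarianceBound.

(** * Length of a geodesic curve *)

Section GeodesicCurve.
Context {R : realType}.

Lemma is_derive_scaler (V : normedModType R) (g : R -> R) (g' t : R) (a : V) :
  is_derive t 1 g g' -> is_derive t 1 (fun s => g s *: a) (g' *: a).
Proof.
move=> [gd gE].
have lim : (fun h => h^-1 *: (g (h *: 1 + t) *: a - g t *: a)) @ 0^' --> g' *: a.
  under eq_fun do rewrite -scalerBl scalerA.
  by apply: cvgZr_tmp; rewrite -gE; exact: gd.
by apply: DeriveDef; [exact: cvgP lim|exact: cvg_lim lim].
Qed.

Context {d : nat}.
Implicit Types (M N : 'M[R]_d) (u : 'rV[R]_d).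

Lemma congexp_rank1 N u :
  congexp N u = \sum_k expR (u 0 k) *: \matrix_(i, j) (N i k * N j k).
Proof.
apply/matrixP => i j; rewrite congexpE summxE; apply: eq_bigr => k _.
by rewrite !mxE.
Qed.

(** The curve is a combination of fixed rank-one matrices with exponential coefficients. *)
Lemma derive1_congexp N u t :
  derive1 (fun s => congexp N (s *: u)) t =
  N *m exp_diag (2^-1 *: (t *: u)) *m diag_mx u *m (N *m exp_diag (2^-1 *: (t *: u)))^T.
Proof.
pose E k : 'M[R]_d := \matrix_(i, j) (N i k * N j k).
have -> : (fun s => congexp N (s *: u)) = \sum_k (fun s : R => expR (s * u 0 k) *: E k).
  apply/funext => s; rewrite congexp_rank1 fct_sumE; apply: eq_bigr => k _.
  by rewrite mxE.
have Edrv k : is_derive t 1 (fun s : R => expR (s * u 0 k) *: E k)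
    ((u 0 k * expR (t * u 0 k)) *: E k).
  apply: is_derive_scaler; apply: is_derive_eq.
  by rewrite scaler0 add0r mulr_algr mulrC.
rewrite derive1E; have [_ ->] := is_derive_sum Edrv.
rewrite trmx_mul tr_exp_diag; apply/matrixP => i j; rewrite summxE.
rewrite !mulmxA exp_diag.unlock mxE; apply: eq_bigr => k _.
have -> : expR (t * u 0 k) = expR (2^-1 * (t * u 0 k)) * expR (2^-1 * (t * u 0 k)).
  by rewrite -expRD; congr expR; lra.
by rewrite !mul_mx_diag !mxE; ring.
Qed.

(** The speed is constant: whitening at time t replaces M exp(t u / 2) by an orthogonal matrix. *)
Lemma normAI_congexp N u t : N \in unitmx ->
  normAI (congexp N (t *: u)) (derive1 (fun s => congexp N (s *: u)) t) =
  Num.sqrt (\sum_i u 0 i ^+ 2).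
Proof.
move=> Nu; rewrite derive1_congexp congexp_base.
set N' := N *m _; have N'u : N' \in unitmx by rewrite unitmx_mul Nu exp_diag_unit.
have QQ := invsqrtmx_orth N'u; have [Wsym _] := invsqrtmxP (mulmxT_posdef N'u).
rewrite /normAI; set W := invsqrtmx _ in QQ Wsym *.
have -> : W *m (N' *m diag_mx u *m N'^T) *m W = (W *m N') *m diag_mx u *m (W *m N')^T.
  by rewrite [(W *m N')^T]trmx_mul Wsym !mulmxA.
apply: (sqr_inj (frob_norm_ge0 _) (sqrtr_ge0 _)).
rewrite frob_norm_orth // frob_norm_diag sqr_sqrtr //.
by rewrite sumr_ge0 // => i _; exact: sqr_ge0.
Qed.

Lemma lengthAI_congexp N u : N \in unitmx ->
  lengthAI (fun s => congexp N (s *: u)) = (Num.sqrt (\sum_i u 0 i ^+ 2))%:E.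
Proof.
move=> Nu; rewrite /lengthAI.
under eq_integral do rewrite normAI_congexp //.
rewrite integral_cst //= lebesgue_measure_itv /= lte_fin ltr01.
by rewrite oppr0 addr0 mule1.
Qed.

Lemma expR_lipschitz01 (w a b : R) : 0 <= a -> a <= b -> b <= 1 ->
  `|expR (b * w) - expR (a * w)| <= (`|w| * expR `|w|) * (b - a).
Proof.
move=> a0 ab b1.
have key x y : `|y| <= `|w| -> y - x = `|w| * (b - a) ->
    `|expR y - expR x| <= (`|w| * expR `|w|) * (b - a).
  move=> yw yx; have xy : x <= y by rewrite -subr_ge0 yx mulr_ge0 // subr_ge0.
  rewrite ger0_norm ?subr_ge0 ?ler_expR // (le_trans (expR_sub_le x y)) // yx mulrAC.
  by rewrite ler_wpM2r ?subr_ge0 // ler_wpM2l // ler_expR (le_trans (ler_norm _)).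
have [w0|/ltW w0] := leP 0 w.
  apply: key; last by rewrite ger0_norm //; ring.
  by rewrite normrM (ger0_norm (le_trans a0 ab)) ler_piMl.
rewrite distrC; apply: key; last by rewrite ler0_norm //; ring.
by rewrite normrM (ger0_norm a0) ler_piMl // (le_trans ab).
Qed.

Lemma frob_norm_entry_le (A : 'M[R]_d) (c : R) : 0 <= c -> (forall i j, `|A i j| <= c) ->
  frob_norm A <= d%:R * c.
Proof.
move=> c0 Ac; rewrite -(@ler_pXn2r _ 2) ?nnegrE ?frob_norm_ge0 ?mulr_ge0 //.
rewrite frob_norm_sqrE; apply: le_trans (_ : \sum_(i < d) \sum_(j < d) c ^+ 2 <= _).
  apply: ler_sum => i _; apply: ler_sum => j _.
  by rewrite -[X in X <= _]real_normK ?num_real // lerXn2r ?nnegrE.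
by rewrite !sumr_const !card_ord -mulrnA -[_ *+ (d * d)]mulr_natl natrM exprMn [d%:R ^+ 2]expr2.
Qed.

Lemma congexp_lipschitz N u : exists2 C : R, 0 < C & forall a b, 0 <= a -> a <= b -> b <= 1 ->
  frob_norm (congexp N (b *: u) - congexp N (a *: u)) <= C * (b - a).
Proof.
pose K i j := \sum_k `|N i k * N j k| * (`|u 0 k| * expR `|u 0 k|).
pose S := \sum_i \sum_j K i j.
have K0 i j : 0 <= K i j by apply: sumr_ge0 => k _; rewrite !mulr_ge0 // expR_ge0.
have KS i j : K i j <= S.
  rewrite /S (bigD1 i) //= (bigD1 j) //= -addrA lerDl addr_ge0 ?sumr_ge0 // => k _.
  by rewrite sumr_ge0.
have S0 : 0 <= S by rewrite sumr_ge0 // => i _; rewrite sumr_ge0.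
exists (d%:R * S + 1) => [|a b a0 ab b1]; first by rewrite ltr_wpDl // mulr_ge0.
apply: le_trans (_ : d%:R * (S * (b - a)) <= _); last first.
  by rewrite mulrA ler_wpM2r ?subr_ge0 // lerDl.
apply: frob_norm_entry_le => [|i j]; first by rewrite mulr_ge0 // subr_ge0.
apply: le_trans (_ : K i j * (b - a) <= _); last by rewrite ler_wpM2r ?subr_ge0.
rewrite mxE [X in _ + X]mxE !congexpE -sumrB /K mulr_suml.
apply: (le_trans (ler_norm_sum _ _ _)); apply: ler_sum => k _.
rewrite -mulrBl normrM mulrC -mulrA ler_wpM2l // !mxE.
exact: expR_lipschitz01.
Qed.

Lemma congexp_abs_continuous N u : abs_continuous01 (fun s => congexp N (s *: u)).
Proof.
have [C C0 lip] := congexp_lipschitz N u.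
move=> e e0; exists (e / C) => [|k a b ab _ small]; first by rewrite divr_gt0.
apply: le_lt_trans (_ : C * \sum_(i < k) (b i - a i) < _).
  by rewrite mulr_sumr; apply: ler_sum => i _; have [? ? ?] := ab i; exact: lip.
by rewrite mulrC -ltr_pdivlMr.
Qed.

End GeodesicCurve.

(** * The condition-number certificate *)

Section KroneckerConditionNumber.
Context {R : realType} {m n : nat}.
Context (mn_ge2 : (2 <= m * n)%N).
Implicit Types (G H : 'M[R]_(n * m)).

Let nm_gt0 : (0 < n * m)%N.
Proof. by rewrite mulnC (leq_trans _ mn_ge2). Qed.

Lemma quarter_square_gt0 : 0 < ((m * n) ^ 2 %/ 4)%:R :> R.
Proof.
by rewrite ltr0n divn_gt0 //; apply: (@leq_trans (2 ^ 2)); rewrite ?leq_exp2r.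
Qed.

(** Rescaling G by exp c translates the log-spectrum of the pencil without
    changing its spread; c is chosen as the mean. *)
Lemma alpha_dAI_set_le G H : posdefmx H -> kron_family m n G ->
  alpha R m n * dAI_set H (kron_family m n) <= ln (kappa_pencil G H).
Proof.
move=> Hpos Gk; have Gpos := kron_posdef Gk.
have [M [u [Mu GE HE]]] := posdef_pair Gpos Hpos.
have [i [j [ui uj]]] := kappa_pencil_congexp u nm_gt0 Mu.
rewrite -GE -HE => ->; rewrite expRK.
have s0 : 0 <= u 0 i - u 0 j by rewrite subr_ge0.
have [|c] := @popoviciu R _ (fun k => u 0 k) (u 0 j) (u 0 i - u 0 j) nm_gt0.
  by move=> k; rewrite uj subrKC ui.
have cGE : expR c *: G = congexp M (const_mx c).
  apply/matrixP => p q; rewrite GE !mxE congexpE mulr_sumr; apply: eq_bigr => k _.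
  by rewrite !mxE.
have := dAI_set_le H (kron_familyZ (expR_gt0 c) Gk).
rewrite -(@ler_pXn2r _ 2) ?nnegrE ?dAI_ge0 ?(dAI_set_ge0 _ Gk) //.
rewrite cGE [X in dAI X (congexp _ _)]HE (dAI_congexp u (const_mx c) Mu).
under eq_bigr do rewrite mxE -sqrrN opprB.
rewrite -(@ler_pXn2r _ 2 _ (alpha R m n * _)) ?nnegrE ?mulr_ge0 ?sqrtr_ge0 ?(dAI_set_ge0 _ Gk) //.
rewrite exprMn /alpha sqr_sqrtr ?divr_ge0 ?ler0n //.
move: (dAI_set _ _ ^+ 2) (\sum_k _) (u 0 i - u 0 j) quarter_square_gt0 => x y s F0 xy.
rewrite (mulnC n m) => h.
rewrite mulrAC ler_pdivrMr //; apply: le_trans (ler_wpM2l (ler0n _ _) xy) _.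
by rewrite [leRHS]mulrC.
Qed.

Lemma lbound_kappa H : posdefmx H ->
  lbound [set kappa_pencil G H | G in kron_family m n] 1.
Proof.
by move=> Hpos _ [G Gk <-]; exact: kappa_pencil_ge1 nm_gt0 (kron_posdef Gk) Hpos.
Qed.

Lemma kron_kappa_min_le G H : posdefmx H -> kron_family m n G ->
  kron_kappa_min H <= kappa_pencil G H.
Proof.
move=> Hpos Gk; apply: ge_inf; last by exists G.
by exists 1; exact: lbound_kappa.
Qed.

Lemma le_kron_kappa_min G H x : kron_family m n G ->
  (forall G', kron_family m n G' -> x <= kappa_pencil G' H) -> x <= kron_kappa_min H.
Proof.
move=> Gk le_x; apply: lb_le_inf; first by exists (kappa_pencil G H), G.
by move=> _ [G' G'k <-]; exact: le_x.
Qed.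

Lemma kron_cost_le (K : R) G G0 H : posdefmx H -> kron_family m n G -> kron_family m n G0 ->
  kappa_pencil G H <= K -> (kron_cost K (whiten H G0) H <= (dAI G0 G)%:E)%E.
Proof.
move=> Hpos Gk G0k le_K; have [M [u [Mu G0E GE geo]]] := kron_family_geodesic G0k Gk.
have [Wsym _] := invsqrtmxP Hpos; pose N := invsqrtmx H *m M.
have Nu : N \in unitmx by rewrite unitmx_mul Mu invsqrtmx_unit.
have curveE t : congexp N (t *: u) = whiten H (congexp M (t *: u)).
  by rewrite /whiten -{2}Wsym congexp_congr.
apply: ereal_inf_lbound; exists (fun t => congexp N (t *: u)); last first.
  rewrite lengthAI_congexp //; congr _%:E.
  apply: (sqr_inj (sqrtr_ge0 _) (dAI_ge0 _ _)).
  rewrite {1}G0E {1}GE dAI_base // sqr_sqrtr //.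
  by rewrite sumr_ge0 // => k _; exact: sqr_ge0.
split.
- exact: congexp_abs_continuous.
- by move=> t _; exists (congexp M (t *: u)); [exact: geo|rewrite curveE].
- by rewrite curveE scale0r congexp0 -G0E.
have [Spos kE] := kappa_whiten nm_gt0 (kron_posdef Gk) Hpos.
by rewrite curveE scale1r -GE; split=> //; rewrite kE.
Qed.

End KroneckerConditionNumber.

Theorem theorem5p18 (R : realType) (m n : nat) (K : R) (H G : 'M[R]_(n * m))
    (mn_ge2 : (2 <= m * n)%N) (K_ge1 : 1 <= K)
    (H_posdef : posdefmx H) (G_kron : kron_family m n G) :
  let P := kron_proj H in
  let V := log_kron_proj (whitened_log G H) in
  let eta := frob_norm V in
  let rho := dAI H G in
  let delta := Num.sqrt (Num.max (rho ^+ 2 - eta ^+ 2) 0) in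
  let kappaG := kappa_pencil G H in
  let kappaP := kappa_pencil P H in
  let a := alpha R m n in
  let delta_star := dAI_set H (kron_family m n) in
  let Kstar := kron_kappa_min H in
  (delta <= delta_star /\ delta_star <= rho) /\
  (expR (a * delta) <= Kstar /\ Kstar <= kappaG) /\
  (kappaG <= K ->
    kron_region K H G /\
    forall G0 : 'M[R]_(n * m), kron_family m n G0 ->
      (kron_cost K (whiten H G0) H <= (dAI G0 G)%:E)%E) /\
  (expR (- (2 * eta)) * kappaG <= kappaP /\
   kappaP <= expR (2 * eta) * kappaG) /\
  [/\ 0 <= ln (kappaP / Kstar),
      ln (kappaP / Kstar) <= ln kappaP - a * delta_star &
      ln kappaP - a * delta_star <= ln kappaG + 2 * eta - a * delta] /\
  (expR (2 * eta) * kappaG <= K -> kappaP <= K) /\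
  (K < expR (- (2 * eta)) * kappaG -> K < kappaP) /\
  (K < expR (a * delta) -> kron_region K H = set0).
Proof.
move=> P V eta rho delta kappaG kappaP a delta_star Kstar.
have /andP[m_gt0 n_gt0] : (0 < m)%N && (0 < n)%N.
  by rewrite -muln_gt0 (leq_trans _ mn_ge2).
have nm_gt0 : (0 < n * m)%N by rewrite muln_gt0 n_gt0.
have [P_kron P_min] := kron_projP m_gt0 n_gt0 H_posdef.
rewrite -/P in P_kron P_min.
have [G_posdef P_posdef] := (kron_posdef G_kron, kron_posdef P_kron).
have eta_ge0 : 0 <= eta := frob_norm_ge0 _.
have a_ge0 : 0 <= a := sqrtr_ge0 _.
have residual : rho ^+ 2 - eta ^+ 2 = frob_norm (whitened_log G H - V) ^+ 2.
  rewrite /rho (dAI_sym H_posdef G_posdef) dAI_whitened_log.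
  by rewrite (frob_norm_log_kron_proj m_gt0 n_gt0 (whitened_log_sym G_posdef H_posdef)) addrK.
have delta_le : delta <= delta_star.
  apply: lb_le_inf; first by exists (dAI H G), G.
  move=> _ [G' G'k <-].
  rewrite -(@ler_pXn2r _ 2) ?nnegrE ?sqrtr_ge0 ?dAI_ge0 //.
  rewrite sqr_sqrtr ?le_max ?lexx ?orbT // ge_max sqr_ge0 andbT residual.
  exact: frob_whitened_residual_le_dAI.
have kappa_ge x : kron_family m n x -> 1 <= kappa_pencil x H.
  by move=> /kron_posdef xpos; exact: kappa_pencil_ge1.
have star_le G' : kron_family m n G' -> expR (a * delta_star) <= kappa_pencil G' H.
  move=> G'k; rewrite -ler_ln ?posrE ?expR_gt0 ?(lt_le_trans ltr01) ?kappa_ge // expRK.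
  exact: alpha_dAI_set_le.
have Kstar_ge : expR (a * delta_star) <= Kstar by exact: le_kron_kappa_min G_kron star_le.
have le_Kstar : expR (a * delta) <= Kstar.
  by apply: le_trans Kstar_ge; rewrite ler_expR ler_wpM2l.
have Kstar_gt0 : 0 < Kstar by exact: lt_le_trans (expR_gt0 _) Kstar_ge.
have Kstar_le G' : kron_family m n G' -> Kstar <= kappa_pencil G' H.
  exact: kron_kappa_min_le.
have GP_eta : dAI G P <= eta by exact: dAI_kron_proj_le.
have kP_le : kappaP <= expR (2 * eta) * kappaG by exact: kappa_pencil_lipschitz.
have kP_ge : expR (- (2 * eta)) * kappaG <= kappaP.
  rewrite expRN ler_pdivrMl ?expR_gt0 //; apply: kappa_pencil_lipschitz => //.
  by rewrite (dAI_sym P_posdef G_posdef).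
have kG_gt0 : 0 < kappaG by rewrite (lt_le_trans ltr01) // kappa_ge.
have kP_gt0 : 0 < kappaP by rewrite (lt_le_trans ltr01) // kappa_ge.
have lnE : ln (kappaP / Kstar) = ln kappaP - ln Kstar by rewrite ln_div ?posrE.
split; first by split=> //; exact: dAI_set_le.
split; first by split=> //; exact: Kstar_le.
split.
  move=> le_K; split=> // G0 G0_kron; exact: kron_cost_le.
split=> //; split.
  split.
  - by rewrite lnE subr_ge0 ler_ln ?posrE // Kstar_le.
  - by rewrite lnE lerD2l lerN2 -(expRK (a * delta_star)) ler_ln ?posrE ?expR_gt0.
  apply: lerB; last by rewrite ler_wpM2l.
  have ln_le (x y e : R) : 0 < x -> 0 < y -> y <= expR e * x -> ln y <= ln x + e.
    move=> x0 y0 yx; rewrite -[e in leRHS]expRK addrC -lnM ?posrE ?expR_gt0 //.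
    by rewrite ler_ln ?posrE ?mulr_gt0 ?expR_gt0.
  exact: ln_le.
split; first by move=> le_K; exact: le_trans kP_le le_K.
split; first by move=> lt_K; exact: lt_le_trans lt_K kP_ge.
move=> lt_K; apply/seteqP; split=> // G' [G'k le_K].
have := lt_le_trans lt_K (le_trans le_Kstar (Kstar_le _ G'k)).
by rewrite ltNge le_K.
Qed.
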